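(* Let $\Delta\geq 5$ be an integer. There exists $M=M(\Delta)>0$ such that for all sufficiently large real $q$, the following holds for any real $\beta\geq \beta_c$. W.h.p. over $G\sim \mathcal{G}_{n,\Delta}$, $G$ has WSM within the ordered phase at a radius $r$ which satisfies $r\leq \frac{M}{\beta}\log n$.
   Context: For an integer $n$ with $\Delta n$ even, $\mathcal{G}_{n,\Delta}$ is the set of all $\Delta$-regular graphs with $n$ vertices, and $G\sim\mathcal{G}_{n,\Delta}$ denotes a uniformly random element. W.h.p. means with probability $1-o_n(1)$ as $n\to\infty$. Random cluster (RC) model: for a graph $G=(V,E)$ and reals $q,\beta>0$, configurations are maps $\mathcal{F}:E\to\{0,1\}$; $\Omega$ is the set of all configurations; $\mathrm{In}(\mathcal{F})$ is the set of edges mapped to $1$ (''in''), the others are ''out''; $c(\mathcal{F})$ is the number of connected components of $(V,\mathrm{In}(\mathcal{F}))$. The weight of $\mathcal{F}$ is $w_G(\mathcal{F})=q^{c(\mathcal{F})}(\mathrm{e}^\beta-1)^{|\mathrm{In}(\mathcal{F})|}$ and $\pi_G(\mathcal{F})=w_G(\mathcal{F})/\sum_{\mathcal{F}'\in\Omega}w_G(\mathcal{F}')$. The threshold $\beta_c=\beta_c(q,\Delta)$ is the ordered/disordered threshold on random $\Delta$-regular graphs, given (for $q>2$) by $\beta_c=\log\frac{q-2}{(q-1)^{1-2/\Delta}-1}$; it satisfies $\beta_c=(1+o_q(1))\frac{2\log q}{\Delta}$. Ordered phase: for an $n$-vertex $\Delta$-regular graph $G=(V,E)$ and $\epsilon>0$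 let $\phi_G(\epsilon)=\min_{S\subseteq V;\,0<|S|\leq \epsilon n}\frac{|E(S,V\setminus S)|}{\Delta|S|}$. Fix $\delta=\delta(\Delta)\in(0,1/2)$ such that w.h.p. $G\sim\mathcal{G}_{n,\Delta}$ satisfies $\phi_G(1/2)\geq 1/10$ and $\phi_G(\delta)\geq 5/9$ (such $\delta$ is known to exist for $\Delta\ge5$), and let $\eta=\min(\delta/5,1/100)$. Then $\Omega^{\mathrm{ord}}=\{\mathcal{F}\in\Omega:|\mathrm{In}(\mathcal{F})|\geq(1-\eta)|E|\}$ and $\pi_G^{\mathrm{ord}}$ is $\pi_G$ conditioned on $\Omega^{\mathrm{ord}}$. WSM: $B_r(v)$ is the set of vertices at distance at most $r$ from $v$, and $E(B_r(v))$ is the set of edges with both endpoints in $B_r(v)$. $\pi_{\mathcal{B}_r^+(v)}$ is $\pi_G$ conditioned on all edges in $E\setminus E(B_r(v))$ being in. For an integer $r\geq1$, a graph $G$ with $m$ edges has WSM within the ordered phase at radius $r$ (for parameters $q,\beta$) if for every $v\in V(G)$ and every edge $e$ incident to $v$, $\|\pi_{\mathcal{B}_r^+(v)}(e\mapsto\cdot)-\pi_G^{\mathrm{ord}}(e\mapsto\cdot)\|_{\mathrm{TV}}\leq\frac{1}{100m}$, where $\mu(e\mapsto\cdot)$ denotes the marginal of $\mu$ on the state of $e$. *)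

(* Defs.v *)
From HB Require Import structures.
From mathcomp Require Import all_boot all_order all_algebra.
From mathcomp Require Import all_classical all_reals all_analysis.

Set Implicit Arguments.
Unset Strict Implicit.
Unset Printing Implicit Defensive.

Import Order.TTheory GRing.Theory Num.Theory.
Import numFieldNormedType.Exports.

Local Open Scope classical_set_scope.
Local Open Scope ring_scope.

(* Finite simple graphs on V, given by their edge set: an edge is an unordered
   pair of distinct vertices. *)
Record sgraph (V : finType) : predArgType := SGraph {
  edges :> {set {set V}};
  edgesP : [forall e in edges, #|e| == 2%N] }.
HB.instance Definition _ (V : finType) := [isSub for @edges V].
HB.instance Definition _ (V : finType) := [Finite of sgraph V by <:].

Record edge (V : finType) (G : sgraph V) : predArgType := Edge {
  ends :> {set V};
  endsP : ends \in edges G }.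
HB.instance Definition _ (V : finType) (G : sgraph V) := [isSub for @ends V G].
HB.instance Definition _ (V : finType) (G : sgraph V) :=
  [Finite of edge G by <:].

Definition regular (V : finType) (Delta : nat) (G : sgraph V) : bool :=
  [forall v : V, #|[set e : edge G | v \in ends e]%SET| == Delta].

(* Probability under the uniform distribution on labelled Delta-regular simple
   graphs; it is 0 if there are no such graphs on n vertices. *)
Definition Pr_regular (R : realType) (Delta n : nat)
    (P : sgraph 'I_n -> Prop) : R :=
  #|[set G : sgraph 'I_n | regular Delta G && `[< P G >]]%SET|%:R /
  #|[set G : sgraph 'I_n | regular Delta G]%SET|%:R.

Definition whp (R : realType) (Delta : nat)
    (P : forall n, sgraph 'I_n -> Prop) : Prop :=
  Pr_regular R Delta (@P n)
    @[n --> within [set n | ~~ odd (Delta * n)] \oo] --> (1 : R).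

Definition adj (V : finType) (G : sgraph V) : rel V :=
  fun x y => [set x; y]%SET \in edges G.

(* Graph distance at most r, expressed as a walk of k <= r steps. *)
Definition ball_at (V : finType) (G : sgraph V) (r : nat) (v : V) : {set V} :=
  [set u | [exists k : 'I_r.+1, [exists p : k.-tuple V,
     path (adj G) v p && (last v p == u)]]]%SET.

Definition cut_edges (V : finType) (G : sgraph V) (S : {set V}) :
    {set edge G} :=
  [set e : edge G | (ends e :&: S != finset.set0) &&
                    (ends e :\: S != finset.set0)]%SET.

(* The minimum over an empty family of sets S is +oo by convention; for fixed
   eps > 0 the family is nonempty as soon as eps * #|V| >= 1. *)
Definition expansion (R : realType) (V : finType) (Delta : nat) (G : sgraph V)
    (eps : R) : \bar R :=
  \big[Order.min/+oo%E]_(S : {set V} |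
      (0 < #|S|)%N && (#|S|%:R <= eps * #|V|%:R))
    (#|cut_edges G S|%:R / (Delta * #|S|)%:R)%:E.

Definition config (V : finType) (G : sgraph V) : predArgType :=
  {ffun edge G -> bool}.

Definition In_edges (V : finType) (G : sgraph V) (F : config G) :
    {set edge G} :=
  [set e | F e]%SET.

Definition in_adj (V : finType) (G : sgraph V) (F : config G) : rel V :=
  fun x y => [exists e in In_edges F, ends e == [set x; y]%SET].

Definition components (V : finType) (G : sgraph V) (F : config G) : nat :=
  n_comp (in_adj F) predT.

Definition rc_weight (R : realType) (V : finType) (G : sgraph V) (q beta : R)
    (F : config G) : R :=
  q ^+ components F * (expR beta - 1) ^+ #|In_edges F|.

Definition rc (R : realType) (V : finType) (G : sgraph V) (q beta : R)
    (F : config G) : R :=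
  rc_weight q beta F / \sum_(F' : config G) rc_weight q beta F'.

Definition cond_on (R : realType) (T : finType) (mu : T -> R) (A : {set T}) :
    T -> R :=
  fun x => if x \in A then mu x / \sum_(y in A) mu y else 0.

Definition marginal (R : realType) (V : finType) (G : sgraph V)
    (mu : config G -> R) (e : edge G) : bool -> R :=
  fun s => \sum_(F : config G | (e \in In_edges F) == s) mu F.

Definition tv_dist (R : realType) (T : finType) (mu nu : T -> R) : R :=
  2^-1 * \sum_(x : T) `|mu x - nu x|.

Definition Omega_ord (R : realType) (V : finType) (G : sgraph V) (eta : R) :
    {set config G} :=
  [set F : config G | (1 - eta) * #|edge G|%:R <= #|In_edges F|%:R :> R]%SET.

Definition rc_ord (R : realType) (V : finType) (G : sgraph V) (q beta eta : R) :
    config G -> R :=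
  cond_on (rc q beta) (Omega_ord G eta).

Definition rc_ball_plus (R : realType) (V : finType) (G : sgraph V)
    (q beta : R) (r : nat) (v : V) : config G -> R :=
  cond_on (rc q beta)
    [set F : config G | [forall e : edge G,
       ~~ (ends e \subset ball_at G r v) ==> (e \in In_edges F)]]%SET.

Definition WSM_ord (R : realType) (V : finType) (G : sgraph V)
    (q beta eta : R) (r : nat) : Prop :=
  forall (v : V) (e : edge G), v \in ends e ->
    tv_dist (marginal (rc_ball_plus q beta r v) e)
            (marginal (rc_ord q beta eta) e)
      <= (100 * #|edge G|%:R)^-1.

(* Ordered/disordered threshold on random Delta-regular graphs; the formula is
   meaningful for 2 < q. *)
Definition beta_c (R : realType) (q : R) (Delta : nat) : R :=
  ln ((q - 2) / ((q - 1) `^ (1 - 2 / Delta%:R) - 1)).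

(* Slack in the definition of the ordered phase, for a small-set expansion
   parameter delta. *)
Definition eta_of (R : realType) (delta : R) : R :=
  Num.min (delta / 5) (1 / 100).

(* Main.v *)
From mathcomp Require Import all_boot all_order all_algebra.
From mathcomp Require Import zify ring lra.
Require Import Defs.

Set Implicit Arguments.
Unset Strict Implicit.
Unset Printing Implicit Defensive.

Import Order.TTheory GRing.Theory Num.Theory.

(** Everything rests on edge expansion; once it is granted, the argument is deterministic and
    holds for every regular graph with enough vertices.

    Write [n] for the number of vertices, [m] for the number of edges, [D] for the degree, and
    think of a configuration as its set of open (in) edges.

    Energy against entropy. If few edges are closed, expansion leaves one giant component, and
    cutting off [k] further components takes at least [5 * D * k / 9] closed edges: the boundary
    of every component and the boundary of their union together count each closed edge at most
    twice. A component gains a factor [q] and a closed edge costs a factor [exp beta - 1], which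
    for large [q], at and above the threshold, is about [q ^ (2 / D)] or more. As [2 * 5 / 9 >
    1], every closed edge still costs a factor of about [exp (- beta / 20)]; see
    [comps_in_bound] and [ordered_cost].

    Comparison by swapping. Take independently [X] from the measure conditioned to be open
    outside the ball and [F] from the ordered phase, and let [P] be the set of edges closed in
    [X] or in [F]. If [P] is small, its complement has a giant component; the defect consists of
    [P] and of all edges touching a vertex outside the giant. Let [K] be the connected component
    of the defect that contains the edge [e] under study. All the non-giant components of [X],
    or of [F], live either inside [K] or away from [K], so exchanging [X] and [F] on [K]
    preserves the product of the weights. It also exchanges the states of [e], and when [K]
    stays in the ball and [P] is small it preserves both conditionings. Hence the two marginals
    at [e] differ by at most the probability that [P] is large or that [K] leaves the ball; this
    is [marginal_diff].

    Peierls bounds. Compared with the pair in which all edges of [K] are open, each closed edge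
    of [K] costs a factor [exp (- beta / 20)], and at least a third of [K] is closed in [X] or
    in [F]. The number of connected sets [K] of a given size is controlled by comparison with
    percolation, so a cluster that leaves the ball, hence has more than [r] edges, has
    probability at most [exp (- beta * (r + 1) / 120)]. This is at most [n ^ (- 2)] for [r] the
    integer part of [240 / beta * log n], and such an [r] is so small a multiple of [log n] when
    [beta] is large that the ball has only [O (sqrt n)] edges. Then a large [P] forces a linear
    number of closed edges in [F], which has exponentially small probability. *)

(** * Components of an edge set *)

Section EdgeSets.
Local Open Scope set_scope.
Local Open Scope nat_scope.
Variables (V : finType) (G : sgraph V).
Implicit Types (A B : {set edge G}) (S T C : {set V}) (x y : V) (e f : edge G).

Lemma card_ends e : #|ends e| = 2.
Proof.
by case: e => s /= sG; have /forall_inP/(_ s sG)/eqP := edgesP G.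
Qed.

Lemma ends_pair e x y : x \in ends e -> y \in ends e -> x != y ->
  ends e = [set x; y].
Proof.
move=> xe ye xy; apply/esym/eqP; rewrite eqEcard cards2 xy card_ends leqnn andbT.
apply/subsetP => z; rewrite !inE.
by case/orP => /eqP->.
Qed.

Lemma ends_other e x : x \in ends e -> exists2 y, x != y & ends e = [set x; y].
Proof.
move=> xe; have /card_gt0P[y] : 0 < #|ends e :\ x|.
  by have := cardsD1 x (ends e); rewrite xe card_ends; lia.
rewrite !inE => /andP[yx ye]; exists y; first by rewrite eq_sym.
by apply: ends_pair; rewrite // eq_sym.
Qed.

Definition touch T : {set edge G} := [set e | ends e :&: T != set0].

Lemma touchP T e : reflect (exists2 x, x \in ends e & x \in T) (e \in touch T).
Proof.
rewrite inE; apply: (iffP (set0Pn _)) => [[x]|[x xe xT]].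
  by rewrite inE => /andP[]; exists x.
by exists x; rewrite inE xe.
Qed.

Lemma cut_sub_touch T : cut_edges G T \subset touch T.
Proof. by apply/subsetP => e; rewrite !inE => /andP[]. Qed.

Lemma cutP T e : reflect (exists x y, [/\ x \in T, y \notin T & ends e = [set x; y]])
  (e \in cut_edges G T).
Proof.
rewrite inE; apply: (iffP andP) => [[/set0Pn[x] + /set0Pn[y]]|[x [y [xT yT e_xy]]]].
  rewrite !inE => /andP[xe xT] /andP[yT ye]; exists x, y; split=> //.
  by apply: ends_pair => //; apply: contraNneq yT => <-.
by split; apply/set0Pn; [exists x | exists y]; rewrite e_xy !inE ?xT ?yT eqxx ?orbT.
Qed.

Definition cadj A : rel V := fun x y => [exists e in A, ends e == [set x; y]].
Definition comp_of A x : {set V} := [set y | connect (cadj A) x y].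
Definition comp_set A : {set {set V}} := [set comp_of A x | x : V].

Lemma cadj_sym A : symmetric (cadj A).
Proof. by move=> x y; rewrite /cadj setUC. Qed.

Lemma conn_sym A : connect_sym (cadj A).
Proof. exact: sym_connect_sym (@cadj_sym A). Qed.

Lemma cadj_edge A e x y : e \in A -> x \in ends e -> y \in ends e ->
  connect (cadj A) x y.
Proof.
move=> eA xe ye; have [->//|xy] := eqVneq x y.
by apply: connect1; apply/existsP; exists e; rewrite eA (ends_pair xe ye xy) eqxx.
Qed.

Lemma comp_refl A x : x \in comp_of A x.
Proof. by rewrite inE. Qed.

Lemma comp_eq A x y : y \in comp_of A x -> comp_of A y = comp_of A x.
Proof.
rewrite inE => xy; apply/setP => z; rewrite !inE; symmetry.
exact: same_connect (@conn_sym A) _ _ xy z.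
Qed.

Lemma comp_in A x : comp_of A x \in comp_set A.
Proof. by rewrite imset_f. Qed.

Lemma comp_set_of A C x : C \in comp_set A -> x \in C -> C = comp_of A x.
Proof. by case/imsetP => y _ -> /comp_eq ->. Qed.

Lemma comps_neq0 A C : C \in comp_set A -> 0 < #|C|.
Proof. by case/imsetP => y _ ->; apply/card_gt0P; exists y; apply: comp_refl. Qed.

Lemma comps_triv A : trivIset (comp_set A).
Proof.
apply/trivIsetP => C D CA DA; apply: contraNT.
rewrite -setI_eq0 => /set0Pn[z]; rewrite inE => /andP[zC zD].
by rewrite (comp_set_of CA zC) (comp_set_of DA zD).
Qed.

Lemma n_comp_comps A : n_comp (cadj A) predT = #|comp_set A|.
Proof.
have -> : comp_set A = [set comp_of A x | x in roots (cadj A)].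
  apply/setP => C; apply/imsetP/imsetP => [[x _ ->]|[x _ ->]]; last by exists x.
  exists (fingraph.root (cadj A) x); first exact: (roots_root (@conn_sym A)).
  by symmetry; apply: comp_eq; rewrite inE connect_root.
rewrite card_in_imset; first by apply: eq_card => x; rewrite !inE andbT.
move=> x y; rewrite !inE => /eqP rx /eqP ry /setP/(_ y).
by rewrite !inE connect0 => /(fingraph.rootP (@conn_sym A)); rewrite rx ry.
Qed.

(** Components are a local notion: whether a set is closed and connected only depends on the
    edges that touch it. *)
Lemma comps_local A B T C : A :&: touch T = B :&: touch T ->
  C \in comp_set A -> C \subset T -> C \in comp_set B.
Proof.
move=> AB /imsetP[x _ ->] CT; suff -> : comp_of A x = comp_of B x by apply: comp_in.
have AsB u v : u \in T -> cadj A u v = cadj B u v.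
  move=> uT; apply: eq_existsb => e; have [euv|] := eqVneq (ends e) [set u; v];
    last by rewrite !andbF.
  rewrite !andbT; have := congr1 (fun S : {set edge G} => e \in S) AB; rewrite /= !(inE, in_setI).
  suff -> : ends e :&: T != set0 by rewrite !andbT.
  by apply/set0Pn; exists u; rewrite euv !inE eqxx.
have stepB y : connect (cadj A) x y -> connect (cadj B) x y.
  case/connectP => p; elim/last_ind: p y => [|p z IHp] y /=; first by move=> _ ->.
  rewrite rcons_path last_rcons => /andP[px lz] ->.
  apply: connect_trans (IHp _ px erefl) (connect1 _); rewrite -AsB //.
  by apply: (subsetP CT); rewrite inE; apply/connectP; exists p.
have stepA y : connect (cadj B) x y -> connect (cadj A) x y.
  case/connectP => p; elim/last_ind: p y => [|p z IHp] y /=; first by move=> _ ->.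
  rewrite rcons_path last_rcons => /andP[px lz] ->.
  have xl := IHp _ px erefl; apply: connect_trans (xl) (connect1 _); rewrite AsB //.
  by apply: (subsetP CT); rewrite inE.
by apply/setP => y; rewrite !inE; apply/idP/idP; [apply: stepB | apply: stepA].
Qed.

Definition comps_in A T := #|[set C in comp_set A | C \subset T]|.

Lemma comps_in_local A B T : A :&: touch T = B :&: touch T -> comps_in A T = comps_in B T.
Proof.
move=> AB; apply: eq_card => C; rewrite !inE; have [CT|] := boolP (C \subset T);
  last by rewrite !andbF.
rewrite !andbT; apply/idP/idP => CA.
  exact: comps_local AB CA CT.
exact: comps_local (esym AB) CA CT.
Qed.

Lemma comps_cut A C : C \in comp_set A -> cut_edges G C \subset ~: A.
Proof.
move=> CA; apply/subsetP => e /cutP[x [y [xC yC e_xy]]]; rewrite in_setC.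
apply: contra yC => eA; rewrite (comp_set_of CA xC) inE.
by apply: cadj_edge eA _ _; rewrite e_xy !inE eqxx ?orbT.
Qed.

(** Each edge outside [A] is counted at most twice on the left: if it leaves the union, then
    once for a component and once for the union; otherwise, only for the components of its two
    ends. Counting the union as well is what doubles the bound that the components alone
    would give. *)
Lemma sum_cut_comps A (CC : {set {set V}}) : CC \subset comp_set A ->
  \sum_(C in CC) #|cut_edges G C| + #|cut_edges G (cover CC)|
    <= 2 * #|touch (cover CC) :\: A|.
Proof.
move=> CCA.
have card_sum (W : {set edge G}) : #|W| = \sum_(e : edge G) (e \in W).
  by rewrite -sum1_card big_mkcond.
rewrite card_sum mulnC card_sum big_distrl /=.
under eq_bigr do rewrite card_sum.
rewrite exchange_big -big_split /=; apply: leq_sum => e _.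
have [x xe] : exists x, x \in ends e by apply/card_gt0P; rewrite card_ends.
have [y xy e_xy] := ends_other xe.
have outA C : C \in CC -> e \in cut_edges G C -> e \notin A.
  by move=> /(subsetP CCA) /comps_cut/subsetP H /H; rewrite in_setC.
have cutE C : (e \in cut_edges G C) = (x \in C) (+) (y \in C).
  apply/cutP/idP => [[u [v [uC vC]]]|].
    rewrite e_xy => /setP E; have := E u; have := E v; have := E x; have := E y.
    rewrite !inE !eqxx !orbT /=; do 2 (move=> /esym/orP[] /eqP ?; subst=> //); move: uC vC xy;
      by do ?[move=> -> | move=> /negbTE -> | rewrite eqxx].
  case xC: (x \in C); case yC: (y \in C) => // _; first by exists x, y; rewrite xC yC.
  by exists y, x; rewrite xC yC; split=> //; rewrite setUC.
have cnt z : \sum_(C in CC) (z \in C) = (z \in cover CC).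
  have [/bigcupP[D DCC zD]|zn] := boolP (z \in cover CC).
    rewrite (bigD1 D) //= zD big1 // => C /andP[CCC CD]; apply/eqP; rewrite eqb0.
    apply: contra CD => zC.
    by rewrite (comp_set_of (subsetP CCA _ CCC) zC) (comp_set_of (subsetP CCA _ DCC) zD).
  by rewrite big1 // => C CCC; apply/eqP; rewrite eqb0; apply: contra zn => zC; apply/bigcupP;
    exists C.
have le_sum : \sum_(C in CC) (e \in cut_edges G C) <= (x \in cover CC) + (y \in cover CC).
  rewrite -!cnt -big_split /=; apply: leq_sum => C _; rewrite cutE.
  by case: (x \in C); case: (y \in C).
case eA: (e \in A).
  rewrite in_setD eA /= mul0n big1 ?add0n ?leqn0 ?eqb0.
    apply/negP => /cutP[u [v [/bigcupP[C CCC uC] vn e_uv]]].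
    suff : e \in cut_edges G C by move/(outA _ CCC); rewrite eA.
    apply/cutP; exists u, v; split=> //; apply: contra vn => vC; by apply/bigcupP; exists C.
  by move=> C CCC; apply/eqP; rewrite eqb0; apply/negP => /(outA _ CCC); rewrite eA.
rewrite in_setD eA /= cutE; have := le_sum.
have -> : (e \in touch (cover CC)) = (x \in cover CC) || (y \in cover CC).
  apply/touchP/orP => [[z]|[xT|yT]].
  - by rewrite e_xy !inE => /orP[] /eqP->; [left | right].
  - by exists x.
  - by exists y; rewrite // e_xy !inE eqxx orbT.
by case: (x \in _); case: (y \in _); rewrite /= ?addn0 ?add0n ?addn1 ?mul1n ?mul0n //;
  case: (\sum_(C in CC) _) => [|[|]].
Qed.

End EdgeSets.

(** * Clusters of adjacent edges *)

Lemma connect_short_path (T : finType) (r : rel T) x y : connect r x y ->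
  exists2 p, path r x p /\ last x p = y & (size p < #|connect r x|)%N.
Proof.
case/connectP => p0 pp0 ->; case/shortenP: pp0 => p pp up _; exists p => //.
have <- : #|x :: p| = (size p).+1 by apply/card_uniqP.
by apply: subset_leq_card; apply/subsetP => z /(path_connect pp).
Qed.

Section LineComponents.
Local Open Scope set_scope.
Local Open Scope nat_scope.
Variables (V : finType) (G : sgraph V).
Implicit Types (B K W : {set edge G}) (e f g : edge G).

Definition share_end e f := ends e :&: ends f != set0.
Definition line_adj B : rel (edge G) := fun e f => [&& e \in B, f \in B & share_end e f].
Definition line_comp B e : {set edge G} := [set f in B | connect (line_adj B) e f].
Definition line_boundary K : {set edge G} := [set f in ~: K | [exists g in K, share_end g f]].

Lemma share_endP e f x : x \in ends e -> x \in ends f -> share_end e f.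
Proof. by move=> xe xf; apply/set0Pn; exists x; rewrite inE xe. Qed.

Lemma in_line_boundary K f : (f \in line_boundary K) =
  (f \notin K) && [exists g in K, share_end g f].
Proof. by rewrite in_set in_setC. Qed.

Lemma line_comp_sub B e : line_comp B e \subset B.
Proof. by apply/subsetP => f; rewrite inE => /andP[]. Qed.

Lemma line_comp_refl B e : e \in B -> e \in line_comp B e.
Proof. by move=> eB; rewrite inE eB connect0. Qed.

Lemma line_comp_step B e f g : f \in line_comp B e -> g \in B -> share_end f g ->
  g \in line_comp B e.
Proof.
rewrite !inE => /andP[fB ef] gB fg; rewrite gB; apply: connect_trans ef (connect1 _).
by rewrite /line_adj fB gB.
Qed.

Lemma line_comp_out B e : e \notin B -> line_comp B e = set0.
Proof.
move=> eB; apply/setP => f; rewrite !inE; apply/andP => -[fB /connectP[[|g p] /=]].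
  by move=> _ fe; move: eB; rewrite -fe fB.
by rewrite /line_adj (negbTE eB).
Qed.

(** Only the presence of the cluster and the absence of its boundary matter, so distinct
    clusters of [e] are witnessed by disjoint families of sets [W]. *)
Lemma line_comp_local B W e : e \in B -> line_comp B e \subset W ->
  [disjoint W & line_boundary (line_comp B e)] ->
  line_comp W e = line_comp B e.
Proof.
move=> eB; set K := line_comp B e => KW dW; have eK : e \in K by apply: line_comp_refl.
apply/setP => f; apply/idP/idP.
  rewrite inE => /andP[_ /connectP[p]]; elim/last_ind: p f => [|p g IHp] f /=; first by move=> _ ->.
  rewrite rcons_path last_rcons => /andP[pp /and3P[_ gW lg]] ->.
  have lK := IHp _ pp erefl; have [//|gK] := boolP (g \in K).
  have /disjoint_setI0/setP/(_ g) := dW;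
    rewrite in_setI gW in_line_boundary gK in_set0 /= => /existsP[].
  by exists (last e p); rewrite lK.
rewrite inE => /andP[_ /connectP[p]]; elim/last_ind: p f => [|p g IHp] f /=.
  by move=> _ ->; rewrite inE (subsetP KW) //= connect0.
rewrite rcons_path last_rcons => /andP[pp /and3P[lB gB lg]] ->.
have := IHp _ pp erefl => /line_comp_step; apply=> //; apply: (subsetP KW).
by apply: line_comp_step lg => //; rewrite inE lB; apply/connectP; exists p.
Qed.

Lemma line_comp_idem B e : line_comp (line_comp B e) e = line_comp B e.
Proof.
have [eB|eB] := boolP (e \in B); last by rewrite (line_comp_out eB) line_comp_out // in_set0.
apply: line_comp_local => //; rewrite -setI_eq0; apply/eqP/setP => f;
  rewrite in_setI in_line_boundary in_set0.
by case: (f \in line_comp B e).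
Qed.

Lemma adj_edge f x y : x \in ends f -> y \in ends f -> x != y -> adj G x y.
Proof. by move=> xf yf xy; rewrite /adj -(ends_pair xf yf xy); case: f {xf yf}. Qed.

Lemma ball_at_mono r s v : r <= s -> ball_at G r v \subset ball_at G s v.
Proof.
move=> rs; apply/subsetP => u; rewrite !inE => /existsP[k /existsP[p pp]].
have ks : k < s.+1 by apply: leq_trans (ltn_ord k) _; rewrite ltnS.
by apply/existsP; exists (Ordinal ks); apply/existsP; exists p.
Qed.

Lemma ball_at_step r v f x y : x \in ends f -> y \in ends f -> x \in ball_at G r v ->
  y \in ball_at G r.+1 v.
Proof.
move=> xf yf; have [<-|xy] := eqVneq x y; first by apply: (subsetP (ball_at_mono v (leqnSn r))).
rewrite !inE => /existsP[k /existsP[p /andP[pp /eqP lp]]].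
have kr : k.+1 < r.+2 by rewrite ltnS.
apply/existsP; exists (Ordinal kr); apply/existsP; exists [tuple of rcons p y].
by rewrite /= rcons_path last_rcons pp lp eqxx andbT (adj_edge xf yf xy).
Qed.

Lemma ball_at0 v : ball_at G 0 v = [set v].
Proof.
apply/setP => u; rewrite !inE; apply/existsP/eqP => [[k /existsP[p]]|->].
  have : size p = 0 by rewrite size_tuple; have := ltn_ord k; rewrite ltnS leqn0 => /eqP.
  by move/size0nil => -> /eqP.
by exists ord0; apply/existsP; exists [tuple]; rewrite /= eqxx.
Qed.

Lemma ball_atS r v u : u \in ball_at G r.+1 v ->
  u \in ball_at G r v \/ exists f x, [/\ x \in ends f, u \in ends f & x \in ball_at G r v].
Proof.
rewrite inE => /existsP[[k kr] /existsP[[p /= sp] /andP[pp /eqP lp]]].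
case: k kr sp => [|k] kr sp.
  left; rewrite inE; apply/existsP; exists ord0; apply/existsP; exists [tuple]; rewrite /=.
  by rewrite -lp; move: sp => /eqP/size0nil ->.
right; case/lastP: p sp pp lp => [|p w]; first by [].
rewrite size_rcons rcons_path last_rcons => sp /andP[pp aw] wu; subst w.
exists (Edge aw), (last v p); rewrite /= !inE !eqxx orbT; split=> //.
have kr' : k < r.+1 by [].
by apply/existsP; exists (Ordinal kr'); apply/existsP; exists (Tuple sp); rewrite /= pp eqxx.
Qed.

(** A cluster has diameter less than its number of edges. *)
Lemma line_comp_escapes B e v r f : v \in ends e -> f \in line_comp B e ->
  ~~ (ends f \subset ball_at G r v) -> r < #|line_comp B e|.
Proof.
move=> ve fK; have [eB|eB] := boolP (e \in B); last by rewrite line_comp_out ?in_set0 in fK.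
rewrite ltnNge; apply: contra => Kr.
move: fK; rewrite inE => /andP[_ /connect_short_path[p [pp <-] psize]].
have cK : #|connect (line_adj B) e| <= #|line_comp B e|.
  apply: subset_leq_card; apply/subsetP => g eg; rewrite in_set; apply/andP; split=> //.
  have /connectP[q] : connect (line_adj B) e g by [].
  case/lastP: q => [_ ->//|q h].
  by rewrite rcons_path last_rcons => /andP[_ /and3P[_ hB _]] ->.
suff H q : path (line_adj B) e q -> ends (last e q) \subset ball_at G (size q).+1 v.
  apply: subset_trans (H _ pp) (ball_at_mono v _).
  exact: leq_trans psize (leq_trans cK Kr).
elim/last_ind: q => [_|q g IHq] /=.
  by apply/subsetP => u ue; apply: ball_at_step ve ue _; rewrite ball_at0 inE.
rewrite rcons_path last_rcons size_rcons => /andP[/IHq sl /and3P[_ _ lg]].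
have /set0Pn[x] := lg; rewrite inE => /andP[xl xg].
by apply/subsetP => u ug; apply: ball_at_step xg ug _; apply: (subsetP sl).
Qed.

End LineComponents.

(** * Regular graphs and balls *)

Section Regular.
Local Open Scope set_scope.
Local Open Scope nat_scope.
Variables (V : finType) (G : sgraph V) (D : nat).
Hypothesis G_reg : regular D G.
Implicit Types (T : {set V}) (x : V) (e : edge G).

Definition incident x : {set edge G} := [set e | x \in ends e].

Lemma card_incident x : #|incident x| = D.
Proof. by have /forallP/(_ x)/eqP := G_reg. Qed.

Lemma card_touch T : #|touch G T| <= D * #|T|.
Proof.
have /subset_leq_card/leq_trans : touch G T \subset \bigcup_(x in T) incident x.
  by apply/subsetP => e /touchP[x xe xT]; apply/bigcupP; exists x; rewrite // inE.
apply; rewrite mulnC -sum_nat_const; apply: (@leq_trans (\sum_(x in T) #|incident x|)).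
  elim/big_rec2: _ => [|x k S _ IH]; first by rewrite cards0.
  by rewrite cardsU; lia.
by apply: leq_sum => x _; rewrite card_incident.
Qed.

Lemma handshake : 2 * #|edge G| = D * #|V|.
Proof.
transitivity (\sum_(x : V) #|incident x|); last first.
  by under eq_bigr do rewrite card_incident; rewrite sum_nat_const mulnC.
transitivity (\sum_(e : edge G) #|ends e|).
  by under eq_bigr do rewrite card_ends; rewrite sum_nat_const mulnC.
have cE (T : finType) (S : {set T}) : #|S| = \sum_(x : T) (x \in S)
  by rewrite -sum1_card big_mkcond.
under eq_bigr do rewrite cE; rewrite exchange_big /=; apply: eq_bigr => x _.
by rewrite cE; apply: eq_bigr => e _; rewrite inE.
Qed.

End Regular.

(** * The giant component of an expander and its fringe *)

Section Giant.
Local Open Scope set_scope.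
Local Open Scope nat_scope.
Variables (V : finType) (G : sgraph V).
Implicit Types (A B P K : {set edge G}) (S T C : {set V}) (x y : V) (e f : edge G).

(** A vertex is giant if its component contains more than half of all vertices, so that there
    is at most one giant component and no choice is involved. *)
Definition giant P : {set V} := [set x | #|V| < 2 * #|comp_of (~: P) x|].
Definition fringe P : {set V} := ~: giant P.
(** The defect contains all edges at the fringe so that two fringe vertices that are adjacent,
    by an open or closed edge, belong to the same cluster of the defect. *)
Definition defect P : {set edge G} := P :|: touch G (fringe P).

Lemma giant_conn P x y : x \in giant P -> y \in giant P -> y \in comp_of (~: P) x.
Proof.
rewrite !inE => gx gy; have [xy|] := boolP (connect _ x y) => //.
have [d0|/set0Pn[z]] := eqVneq (comp_of (~: P) x :&: comp_of (~: P) y) set0; last first.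
  rewrite !inE => /andP[xz yz] /negP[]; apply: connect_trans xz _.
  by rewrite (@conn_sym _ G (~: P)).
have : #|comp_of (~: P) x :|: comp_of (~: P) y| <= #|V| by apply: max_card.
by rewrite cardsU d0 cards0; lia.
Qed.

Lemma giant_closed P x y : x \in giant P -> y \in comp_of (~: P) x -> y \in giant P.
Proof. by rewrite inE => gx /comp_eq E; rewrite inE E. Qed.

Lemma giantE P x : x \in giant P -> giant P = comp_of (~: P) x.
Proof.
move=> gx; apply/setP => y; apply/idP/idP; first exact: giant_conn.
exact: giant_closed.
Qed.

(** [L] is the largest number of closed edges that the ordered phase allows. The constants are
    those of the expansions 1/10 and 5/9. The sets called small here are those that a boundary of
    [L] edges can cut off when the expansion is 1/10. *)
Record expander D L : Prop := Expander {
  expander_regular : regular D G;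
  expander_half : forall S, 0 < #|S| -> 2 * #|S| <= #|V| -> D * #|S| <= 10 * #|cut_edges G S|;
  expander_small : forall S, D * #|S| <= 10 * L -> 5 * D * #|S| <= 9 * #|cut_edges G S|;
  expander_budget : 20 * L < D * #|V| }.

Variables D L : nat.
Hypothesis GX : expander D L.

(** Otherwise all components contain at most half of the vertices, and by expansion their
    boundaries would use more than [2 * L] sides of edges of [P]. *)
Lemma giant_exists P : #|P| <= L -> exists x, x \in giant P.
Proof.
move=> PL; apply/existsP; apply: contraLR (expander_budget GX); rewrite -leqNgt => /existsPn nog.
have := sum_cut_comps (subxx (comp_set (~: P))); set s := \sum_(C in _) _ => Hs.
have Dn : D * #|V| <= 10 * s.
  have -> : #|V| = \sum_(C in comp_set (~: P)) #|C|.
    have /eqP -> := comps_triv (~: P); rewrite -cardsT; apply: eq_card => x.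
    rewrite inE; symmetry; apply/bigcupP; exists (comp_of (~: P) x); first exact: comp_in.
    exact: comp_refl.
  rewrite !big_distrr /=; apply: leq_sum => C CP; apply: (expander_half GX);
    first exact: comps_neq0 CP.
  by have := CP => /imsetP[x _ ->]; have := nog x; rewrite inE -leqNgt.
have : #|touch G (cover (comp_set (~: P))) :\: ~: P| <= #|P|.
  by apply: subset_leq_card; apply/subsetP => e; rewrite in_setD in_setC negbK => /andP[].
lia.
Qed.

Lemma cut_fringe P : cut_edges G (fringe P) \subset P.
Proof.
apply/subsetP => e /cutP[x [y [xU yU e_xy]]]; move: xU yU; rewrite !in_setC negbK => xU yU.
apply: contraR xU => eP; apply: giant_closed yU _; rewrite inE.
by apply: (@cadj_edge _ _ _ e); rewrite ?in_setC // e_xy !inE eqxx ?orbT.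
Qed.

Lemma fringe_half P : #|P| <= L -> 2 * #|fringe P| <= #|V|.
Proof.
move=> /giant_exists[x xg]; have := xg; rewrite inE -(giantE xg).
by have := cardsC (giant P); rewrite -/(fringe P); lia.
Qed.

Lemma card_fringe P : #|P| <= L -> D * #|fringe P| <= 10 * L.
Proof.
move=> PL; have [->|] := posnP #|fringe P|; first by rewrite muln0.
move/(expander_half GX) => /(_ (fringe_half PL)) /leq_trans; apply.
by rewrite leq_mul2l /=; apply: leq_trans PL; apply: subset_leq_card (cut_fringe P).
Qed.

(** The fringe is small enough for the expansion 5/9. It applies to each component inside [T]
    and to their union, which together see each closed edge at most twice, and a component has
    at least one vertex. *)
Lemma comps_in_bound P A T : #|P| <= L -> T \subset fringe P ->
  5 * D * comps_in A T <= 9 * #|touch G T :\: A|.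
Proof.
move=> PL TU; set CC := [set C in comp_set A | C \subset T].
have CCA : CC \subset comp_set A by apply/subsetP => C; rewrite inE => /andP[].
have CT : cover CC \subset T by apply/bigcupsP => C; rewrite inE => /andP[].
have small S : S \subset T -> 5 * D * #|S| <= 9 * #|cut_edges G S|.
  move=> ST; apply: (expander_small GX); apply: leq_trans (card_fringe PL).
  by rewrite leq_mul2l subset_leq_card ?orbT // (subset_trans ST).
have cov : #|cover CC| = \sum_(C in CC) #|C|.
  by apply/esym/eqP; apply: trivIsetS CCA (comps_triv A).
have nc : #|CC| <= #|cover CC|.
  rewrite cov -sum1_card; apply: leq_sum => C /(subsetP CCA); exact: comps_neq0.
have := sum_cut_comps CCA; set s := \sum_(C in CC) #|cut_edges G C| => Hs.
have Hs1 : 5 * D * #|cover CC| <= 9 * s.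
  rewrite cov !big_distrr /=; apply: leq_sum => C; rewrite inE => /andP[_ /small].
  by [].
have := small _ CT => Hs2.
have : #|touch G (cover CC) :\: A| <= #|touch G T :\: A|.
  apply: subset_leq_card; apply: setSD; apply/subsetP => e /touchP[x xe xC].
  by apply/touchP; exists x => //; apply: (subsetP CT).
have : 5 * D * #|CC| <= 5 * D * #|cover CC| by rewrite leq_mul2l nc orbT.
rewrite /comps_in -/CC; move: Hs Hs1 Hs2.
by move: (5 * D * #|CC|) (5 * D * #|cover CC|) => a b; lia.
Qed.

(** No edge of the giant component belongs to the defect, so the giant is connected by edges
    that any configuration closed only within the defect contains. *)
Lemma giant_comp P A x : ~: defect P \subset A -> x \in giant P -> giant P \subset comp_of A x.
Proof.
move=> BA gx; have gE := giantE gx.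
have : giant P \in comp_set (~: defect P).
  apply: (@comps_local _ _ (~: P) _ (giant P)) => //; last by rewrite gE comp_in.
  apply/setP => e; rewrite !in_setI !in_setC in_setU negb_or; apply/andP/andP => -[].
    move=> eP eg; rewrite eP eg; split=> //=; have /touchP[y ye yg] := eg.
    apply/touchP => -[z ze]; rewrite in_setC => /negP[]; apply: giant_closed yg _.
    by rewrite inE; apply: cadj_edge ye ze; rewrite in_setC.
  by move=> /andP[-> _] ->.
move=> /comp_set_of/(_ gx) ->; apply/subsetP => y; rewrite !inE.
apply: connect_sub => u v /existsP[e /andP[eB uv]]; apply: connect1.
by apply/existsP; exists e; rewrite (subsetP BA).
Qed.

Lemma comps_split P A : #|P| <= L -> ~: defect P \subset A ->
  #|comp_set A| = (comps_in A (fringe P)).+1.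
Proof.
move=> /giant_exists[x gx] BA; have gA := giant_comp BA gx.
have -> : comp_set A = comp_of A x |: [set C in comp_set A | C \subset fringe P].
  apply/setP => C; rewrite !inE; apply/idP/orP => [CA|[/eqP->|/andP[]//]]; last exact: comp_in.
  have [CU|/subsetPn[y yC]] := boolP (C \subset fringe P); first by right; rewrite CA.
  rewrite in_setC negbK => yg; left; rewrite (comp_set_of CA yC); apply/eqP; apply: comp_eq.
  exact: (subsetP gA).
rewrite cardsU1 inE negb_and; suff -> : ~~ (comp_of A x \subset fringe P) by rewrite orbT.
by apply/subsetPn; exists x; rewrite ?comp_refl // in_setC negbK.
Qed.

Section Cluster.
Variables (P : {set edge G}) (e0 : edge G).
Let K := line_comp (defect P) e0.

Definition fringe_part : {set V} :=
  [set x in fringe P | [exists f in line_comp (defect P) e0, x \in ends f]].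

Lemma fringe_part_sub : fringe_part \subset fringe P.
Proof. by apply/subsetP => x; rewrite inE => /andP[]. Qed.

Lemma touch_fringe_part : touch G fringe_part \subset K.
Proof.
apply/subsetP => e /touchP[x xe]; rewrite inE => /andP[xU /existsP[f /andP[fK xf]]].
apply: line_comp_step fK _ (share_endP xf xe); rewrite in_setU; apply/orP; right.
by apply/touchP; exists x.
Qed.

Lemma touch_fringe_rest : [disjoint touch G (fringe P :\: fringe_part) & K].
Proof.
rewrite -setI_eq0; apply/eqP/setP => e; rewrite in_setI in_set0; apply/andP => -[/touchP[x xe]].
by rewrite in_setD => /andP[+ xU] eK; rewrite inE xU /= => /existsP[]; exists e; rewrite eK.
Qed.

Lemma cut_fringe_part : cut_edges G fringe_part \subset P.
Proof.
apply/subsetP => e ec; have := ec => /cutP[x [y [xN yN e_xy]]].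
have eK : e \in K by apply: (subsetP touch_fringe_part);
  apply: (subsetP (cut_sub_touch G fringe_part)).
apply: (subsetP (cut_fringe P)); apply/cutP; exists x, y; split=> //.
  exact: (subsetP fringe_part_sub).
apply: contra yN => yU; rewrite inE yU; apply/existsP; exists e; rewrite eK e_xy.
by rewrite !inE eqxx orbT.
Qed.

(** An edge between two fringe vertices belongs to the cluster as soon as one of its ends is
    reached by the cluster, so no component of [A] straddles the two parts of the fringe. *)
Lemma comps_in_split A : comps_in A (fringe P) =
  comps_in A fringe_part + comps_in A (fringe P :\: fringe_part).
Proof.
have cross C : C \in comp_set A -> C \subset fringe P ->
  ~~ (C \subset fringe P :\: fringe_part) -> C \subset fringe_part.
  move=> CA CU /subsetPn[x xC]; rewrite in_setD (subsetP CU) // andbT negbK => xN.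
  apply/subsetP => y; have CE := comp_set_of CA xC; rewrite {1}CE inE => /connectP[p].
  elim/last_ind: p y => [|p z IHp] y /=; first by move=> _ ->.
  rewrite rcons_path last_rcons => /andP[px lz] ->; have lN := IHp _ px erefl.
  have /existsP[f /andP[fA /eqP f_lz]] := lz.
  rewrite inE; apply/andP; split.
    apply: (subsetP CU); rewrite CE inE; apply: connect_trans (connect1 lz).
    by apply/connectP; exists p.
  apply/existsP; exists f; rewrite f_lz in_set2 eqxx orbT andbT.
  by apply: (subsetP touch_fringe_part); apply/touchP; exists (last x p); rewrite // f_lz !inE eqxx.
rewrite /comps_in -cardsUI addnC; set I := _ :&: _; have -> : I = set0.
  apply/setP => C; rewrite !inE; apply/negP => /andP[/andP[CA C1] /andP[_ C2]].
  have /card_gt0P[x xC] := comps_neq0 CA.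
  by have := subsetP C2 _ xC; rewrite in_setD (subsetP C1).
rewrite cards0 add0n; apply: eq_card => C; rewrite !inE -andb_orr.
case CA: (C \in comp_set A); rewrite //=; apply/idP/orP => [CU|[]CN].
- by have [|/(cross _ CA CU)] := boolP (C \subset fringe P :\: fringe_part); [right | left].
- exact: subset_trans fringe_part_sub.
- exact: subset_trans CN (subsetDl _ _).
Qed.

(** An edge of the cluster outside [P] touches the part of the fringe reached by the cluster,
    and that part has a large boundary, all of it in [P]. *)
Lemma cluster_out : #|P| <= L -> #|K| <= 3 * #|K :&: P|.
Proof.
move=> PL; have sK : K \subset (K :&: P) :|: touch G fringe_part.
  apply/subsetP => e eK; have := subsetP (line_comp_sub _ _) _ eK; rewrite !in_setU in_setI eK /=.
  case/orP => [->//|/touchP[x xe xU]]; apply/orP; right; apply/touchP; exists x => //.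
  by rewrite inE xU; apply/existsP; exists e; rewrite eK.
have := subset_leq_card sK; rewrite cardsU => HK.
have tN := card_touch (expander_regular GX) fringe_part.
have : 5 * D * #|fringe_part| <= 9 * #|cut_edges G fringe_part|.
  apply: (expander_small GX); apply: leq_trans (card_fringe PL).
  by rewrite leq_mul2l subset_leq_card ?orbT // fringe_part_sub.
have : #|cut_edges G fringe_part| <= #|K :&: P|.
  apply: subset_leq_card; rewrite subsetI cut_fringe_part andbT.
  exact: subset_trans (cut_sub_touch G fringe_part) touch_fringe_part.
rewrite -mulnA; move: tN; move: (D * #|fringe_part|) => a; lia.
Qed.

End Cluster.

End Giant.

Section Balls.
Local Open Scope set_scope.
Local Open Scope nat_scope.
Variables (V : finType) (G : sgraph V) (D : nat).
Hypothesis G_reg : regular D G.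

Lemma card_ball r v : #|ball_at G r v| <= D.+1 ^ r.
Proof.
elim: r => [|r IHr]; first by rewrite ball_at0 cards1.
have sub : ball_at G r.+1 v \subset
    ball_at G r v :|: \bigcup_(f in touch G (ball_at G r v)) (ends f :\: ball_at G r v).
  apply/subsetP => u /ball_atS[ub|[f [x [xf uf xb]]]]; first by rewrite in_setU ub.
  rewrite in_setU; have [//|un] := boolP (u \in ball_at G r v).
  apply/bigcupP; exists f; last by rewrite in_setD un.
  by apply/touchP; exists x.
apply: leq_trans (subset_leq_card sub) _; apply: leq_trans (leq_card_setU _ _) _.
have : #|\bigcup_(f in touch G (ball_at G r v)) (ends f :\: ball_at G r v)| <= D * #|ball_at G r v|.
  apply: leq_trans (card_touch G_reg _); rewrite -[X in _ <= X]sum1_card.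
  elim/big_rec2: _ => [|f k S /touchP[x xf xb] IH]; first by rewrite cards0.
  apply: leq_trans (leq_card_setU _ _) _; apply: leq_add => //.
  have := cardsID (ball_at G r v) (ends f); rewrite card_ends.
  have : 0 < #|ends f :&: ball_at G r v| by apply/card_gt0P; exists x; rewrite in_setI xf.
  by move: #|_ :&: _| #|_ :\: _| => a b; lia.
by rewrite expnS; nia.
Qed.

Lemma card_ball_edges r v : #|[set e : edge G | ends e \subset ball_at G r v]| <= D.+1 ^ r.+1.
Proof.
have sub : [set e : edge G | ends e \subset ball_at G r v] \subset touch G (ball_at G r v).
  apply/subsetP => f; rewrite inE => /subsetP fb.
  have /card_gt0P[x xf] : 0 < #|ends f| by rewrite card_ends.
  by apply/touchP; exists x => //; apply: fb.
apply: leq_trans (subset_leq_card sub) _; apply: leq_trans (card_touch G_reg _) _.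
by rewrite expnS; apply: leq_mul => //; apply: card_ball.
Qed.

End Balls.

(** * Swapping two configurations on a cluster *)

Section Swap.
Local Open Scope set_scope.
Local Open Scope nat_scope.
Variables (V : finType) (G : sgraph V).
Implicit Types (A B P K X F : {set edge G}) (e f : edge G).

Definition splice K X F := (X :\: K) :|: (F :&: K).

Lemma in_splice K X F e : (e \in splice K X F) = if e \in K then e \in F else e \in X.
Proof. by rewrite !inE; case: (e \in K); rewrite ?andbF ?andbT ?orbF. Qed.

Lemma spliceI K X F : splice K X F :&: splice K F X = X :&: F.
Proof. by apply/setP => e; rewrite !in_setI !in_splice; case: (e \in K); rewrite // andbC. Qed.

Lemma spliceK K X F : splice K (splice K X F) (splice K F X) = X.
Proof. by apply/setP => e; rewrite !in_splice; case: (e \in K). Qed.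

Lemma card_splice K X F : #|splice K X F| + #|splice K F X| = #|X| + #|F|.
Proof.
have E A B : #|splice K A B| = #|A :\: K| + #|B :&: K|.
  rewrite cardsU; suff -> : (A :\: K) :&: (B :&: K) = set0 by rewrite cards0 subn0.
  by apply/setP => e; rewrite !inE; case: (e \in K); rewrite ?andbF.
by rewrite !E -(cardsID K X) -(cardsID K F); lia.
Qed.

(** The edges closed in at least one of the two configurations. The swap below leaves this set
    unchanged, hence also the cluster on which it acts; this makes it an involution. *)
Definition closed_pair X F : {set edge G} := ~: (X :&: F).
Definition cluster e (XF : {set edge G} * {set edge G}) :=
  line_comp (defect (closed_pair XF.1 XF.2)) e.
Definition swap e (XF : {set edge G} * {set edge G}) :=
  (splice (cluster e XF) XF.1 XF.2, splice (cluster e XF) XF.2 XF.1).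

Lemma closed_pair_swap e XF : closed_pair (swap e XF).1 (swap e XF).2 = closed_pair XF.1 XF.2.
Proof. by rewrite /closed_pair spliceI. Qed.

Lemma cluster_swap e XF : cluster e (swap e XF) = cluster e XF.
Proof. by rewrite /cluster closed_pair_swap. Qed.

Lemma swapK e : involutive (swap e).
Proof. by move=> [X F]; rewrite {1}/swap cluster_swap !spliceK. Qed.

(** If [e] is not in its cluster, it is not in the defect, and both configurations contain it. *)
Lemma swap_edge e XF : (e \in (swap e XF).1) = (e \in XF.2).
Proof.
rewrite in_splice; case: ifPn => // eK; have : e \notin defect (closed_pair XF.1 XF.2).
  by apply: contra eK; apply: line_comp_refl.
by rewrite in_setU negb_or in_setC negbK in_setI => /andP[/andP[-> ->]].
Qed.

Variables (D L : nat).
Hypothesis GX : expander G D L.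

Lemma sub_nondefect P X : ~: P \subset X -> ~: defect P \subset X.
Proof. by move=> PX; apply: subset_trans PX; rewrite setCS subsetUl. Qed.

(** Each component is the giant one, or lies in the part of the fringe reached by the cluster,
    or in the rest of the fringe. The number of those of the second kind is determined by the
    configuration on the cluster, the number of those of the third kind by the configuration off
    the cluster. *)
Lemma comps_swap e XF : #|closed_pair XF.1 XF.2| <= L ->
  #|comp_set (swap e XF).1| + #|comp_set (swap e XF).2| = #|comp_set XF.1| + #|comp_set XF.2|.
Proof.
move=> PL; set P := closed_pair _ _ in PL; set K := cluster e XF.
have sub A : XF.1 :&: XF.2 \subset A -> ~: defect P \subset A.
  by move=> ?; apply: sub_nondefect; rewrite setCK.
have cE A : XF.1 :&: XF.2 \subset A ->
    #|comp_set A| = (comps_in A (fringe_part P e) + comps_in A (fringe P :\: fringe_part P e)).+1.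
  by move/sub => sA; rewrite (comps_split GX PL sA) (comps_in_split P e).
have nK A B : comps_in (splice K A B) (fringe_part P e) = comps_in B (fringe_part P e).
  apply: comps_in_local; apply/setP => f; rewrite !in_setI in_splice.
  have [ft|] := boolP (f \in touch G (fringe_part P e)); rewrite ?andbF // !andbT.
  by rewrite (subsetP (touch_fringe_part _ _) _ ft).
have nC A B : comps_in (splice K A B) (fringe P :\: fringe_part P e) =
  comps_in A (fringe P :\: fringe_part P e).
  apply: comps_in_local; apply/setP => f; rewrite !in_setI in_splice.
  have [ft|] := boolP (f \in touch G _); rewrite ?andbF // !andbT.
  by rewrite (disjointFr (touch_fringe_rest P e) ft).
rewrite /= -/K !cE ?subsetIl ?subsetIr //; last 2 first.
- by rewrite -(spliceI K) subsetIr.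
- by rewrite -(spliceI K) subsetIl.
by rewrite !nK !nC; lia.
Qed.

(** Only the [a] components inside the part of the fringe reached by the cluster can disappear,
    and their boundaries are closed edges of the cluster. *)
Lemma comps_open_cluster P X e : #|P| <= L -> ~: P \subset X ->
  exists2 a, #|comp_set X| <= #|comp_set (X :|: line_comp (defect P) e)| + a &
    5 * D * a <= 9 * #|line_comp (defect P) e :\: X|.
Proof.
move=> PL PX; set K := line_comp _ _; exists (comps_in X (fringe_part P e)); last first.
  apply: leq_trans (comps_in_bound GX _ PL (fringe_part_sub P e)) _.
  by rewrite leq_mul2l /=; apply: subset_leq_card; apply: setSD (touch_fringe_part P e).
have XK : ~: P \subset X :|: K by apply: subset_trans PX (subsetUl _ _).
rewrite (comps_split GX PL (sub_nondefect PX)).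
rewrite (comps_split GX PL (sub_nondefect XK)) !(comps_in_split P e).
suff -> : comps_in (X :|: K) (fringe P :\: fringe_part P e) =
  comps_in X (fringe P :\: fringe_part P e) by lia.
apply: comps_in_local; apply/setP => f; rewrite !in_setI in_setU.
have [ft|] := boolP (f \in touch G _); rewrite ?andbF // !andbT.
by rewrite [f \in K](disjointFr (touch_fringe_rest P e) ft) orbF.
Qed.

Lemma comps_ordered F : #|~: F| <= L ->
  exists2 a, #|comp_set F| = a.+1 & 5 * D * a <= 9 * #|~: F|.
Proof.
move=> FL; exists (comps_in F (fringe (~: F))).
  by apply: (comps_split GX FL); apply: sub_nondefect; rewrite setCK.
apply: leq_trans (comps_in_bound GX _ FL (subxx _)) _.
by rewrite leq_mul2l /=; apply: subset_leq_card; rewrite setDE subsetIr.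
Qed.

Lemma card_line_boundary K : #|line_boundary K| <= 2 * D * #|K|.
Proof.
have sub : line_boundary K \subset touch G (\bigcup_(f in K) ends f).
  apply/subsetP => f; rewrite in_line_boundary => /andP[_ /existsP[g /andP[gK /set0Pn[x]]]].
  rewrite inE => /andP[xg xf]; apply/touchP; exists x => //; by apply/bigcupP; exists g.
apply: leq_trans (subset_leq_card sub) _; apply: leq_trans (card_touch (expander_regular GX) _) _.
rewrite -mulnA mulnCA leq_mul2l; apply/orP; right; rewrite mulnC -sum_nat_const.
apply: (@leq_trans (\sum_(f in K) #|ends f|)); last by apply: leq_sum => f _; rewrite card_ends.
elim/big_rec2: _ => [|f k S _ IH]; first by rewrite cards0.
by rewrite cardsU; lia.
Qed.

(** Open each edge independently with probability 1/2. The cluster of [e] is [K] whenever [K] is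
    open and its boundary is closed, and these events are disjoint for distinct [K]. This
    bounds the number of connected sets of edges without any tree counting. *)
Lemma percolation_count e :
  \sum_(K : {set edge G} | (e \in K) && (line_comp K e == K))
     2 ^ (#|edge G| - #|K| - #|line_boundary K|) <= 2 ^ #|edge G|.
Proof.
have -> : 2 ^ #|edge G| = #|{set edge G}|.
  by rewrite -(cardsT (edge G)) -card_powerset powersetT cardsT.
rewrite -[X in _ <= X]sum1_card [X in _ <= X](partition_big (fun W => line_comp W e) predT) //=.
rewrite [X in _ <= X](bigID (fun K => (e \in K) && (line_comp K e == K))) /=.
apply: leq_trans (leq_addr _ _); apply: leq_sum => K /andP[eK /eqP KK].
rewrite sum1_card; set C := ~: (K :|: line_boundary K).
have <- : #|setU K @: powerset C| = 2 ^ (#|edge G| - #|K| - #|line_boundary K|).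
  rewrite card_in_imset.
    rewrite card_powerset; congr (2 ^ _); rewrite /C cardsCs setCK cardsU.
    suff -> : K :&: line_boundary K = set0 by rewrite cards0 subn0 subnDA.
    by apply/setP => f; rewrite in_setI in_line_boundary in_set0; case: (f \in K).
  have E (W : {set edge G}) : W \subset C -> (K :|: W) :&: C = W.
    move=> WC; apply/setP => f; rewrite in_setI in_setU; have [fW|fW] := boolP (f \in W).
      by rewrite orbT (subsetP WC).
    by rewrite orbF in_setC in_setU; case: (f \in K).
  by move=> A B; rewrite !inE => AC BC AB; rewrite -(E A) // -(E B) // AB.
apply: subset_leq_card; apply/subsetP => W /imsetP[W0]; rewrite inE => W0C ->.
suff : line_comp (K :|: W0) e = line_comp K e by rewrite KK => /eqP.
apply: line_comp_local => //; rewrite KK ?subsetUl //.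
rewrite -setI_eq0; apply/eqP/setP => f; rewrite in_setI in_setU in_set0.
have [fK|fK] := boolP (f \in K); first by rewrite in_line_boundary fK.
by apply/negP => /andP[/(subsetP W0C)]; rewrite in_setC in_setU negb_or => /andP[_ /negbTE ->].
Qed.

End Swap.

(** * Peierls bounds for pairs of configurations *)

Section Peierls.
Local Open Scope set_scope.
Local Open Scope ring_scope.
Variables (R : realFieldType) (V : finType) (G : sgraph V) (D L : nat).
Hypothesis GX : expander G D L.
Variables q y tau : R.
Hypothesis q_ge1 : 1 <= q.
Hypothesis y_gt0 : 0 < y.
Hypothesis tau01 : 0 <= tau <= 1.
(* A closed edge is charged [tau ^ 3] because only a third of a cluster is known to be closed. *)
Hypothesis cost : forall k a : nat, (5 * D * k <= 9 * a)%N -> q ^+ k <= y ^+ a * tau ^+ (3 * a).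
Implicit Types (A B P K X F : {set edge G}) (e f : edge G).

Definition rc_wt A : R := q ^+ #|comp_set A| * y ^+ #|A|.
Definition pwt (XF : {set edge G} * {set edge G}) : R := rc_wt XF.1 * rc_wt XF.2.
Definition Z (E : {set {set edge G}}) : R := \sum_(X in E) rc_wt X.

Let q_gt0 : 0 < q. Proof. exact: lt_le_trans q_ge1. Qed.

Lemma ler_sum_subpred (I : finType) (P Q : pred I) (f : I -> R) :
  (forall i, P i -> Q i) -> (forall i, Q i -> 0 <= f i) -> \sum_(i | P i) f i <= \sum_(i | Q i) f i.
Proof.
move=> PQ f0; rewrite [leRHS](bigID P) /= (eq_bigl (fun i => Q i && P i)).
  by rewrite -[leLHS]addr0 lerD2l sumr_ge0 // => i /andP[/f0].
by move=> i; case: (boolP (P i)) => [/(PQ i) -> //|]; rewrite andbF.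
Qed.

Lemma wt_gt0 A : 0 < rc_wt A.
Proof. by rewrite /rc_wt mulr_gt0 // exprn_gt0. Qed.

Lemma pwt_ge0 XF : 0 <= pwt XF.
Proof. by rewrite mulr_ge0 // ltW // wt_gt0. Qed.

Lemma Z_ge0 E : 0 <= Z E.
Proof. by apply: sumr_ge0 => X _; rewrite ltW // wt_gt0. Qed.

Lemma pwt_swap e XF : (#|closed_pair XF.1 XF.2| <= L)%N -> pwt (swap e XF) = pwt XF.
Proof.
have E A B : rc_wt A * rc_wt B = q ^+ (#|comp_set A| + #|comp_set B|) * y ^+ (#|A| + #|B|).
  by rewrite /rc_wt !exprD mulrACA.
by move=> PL; rewrite /pwt !E (comps_swap GX) // card_splice.
Qed.

(** Opening the cluster loses at most [q ^ a] by merging components and gains [y] for each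
    edge that it opens; [cost] says that the gain wins. *)
Lemma wt_open P X e : (#|P| <= L)%N -> ~: P \subset X ->
  rc_wt X <= tau ^+ (3 * #|line_comp (defect P) e :\: X|) * rc_wt (X :|: line_comp (defect P) e).
Proof.
move=> PL PX; have [a ca Da] := comps_open_cluster GX e PL PX.
set K := line_comp _ _ in ca Da *.
have cU : #|X :|: K| = (#|K :\: X| + #|X|)%N.
  by have := cardsUI X K; have := cardsID X K; rewrite setIC; lia.
rewrite /rc_wt cU [y ^+ (_ + _)]exprD.
apply: (@le_trans _ _ (q ^+ (#|comp_set (X :|: K)| + a) * y ^+ #|X|)).
  by rewrite ler_wpM2r ?exprn_ge0 ?(ltW y_gt0) // ler_weXn2l.
rewrite exprD; have := cost Da; move: (y ^+ #|K :\: X|) (tau ^+ _) => u t qa.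
rewrite [leRHS](_ : _ = q ^+ #|comp_set (X :|: K)| * (u * t) * y ^+ #|X|); last first.
  by move: (q ^+ _) (y ^+ _) => v w; ring.
by rewrite ler_wpM2r ?exprn_ge0 ?(ltW y_gt0) // ler_wpM2l ?exprn_ge0 ?(ltW q_gt0).
Qed.

(** Each edge of the cluster that lies in [closed_pair] is opened in at least one of the two
    configurations, and these edges make up a third of the cluster. *)
Lemma pwt_open e XF : (#|closed_pair XF.1 XF.2| <= L)%N ->
  pwt XF <= tau ^+ #|cluster e XF| * pwt (XF.1 :|: cluster e XF, XF.2 :|: cluster e XF).
Proof.
move=> PL; have /andP[t0 t1] := tau01; set K := cluster e XF.
have H1 : rc_wt XF.1 <= tau ^+ (3 * #|K :\: XF.1|) * rc_wt (XF.1 :|: K).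
  by apply: wt_open => //; rewrite setCK subsetIl.
have H2 : rc_wt XF.2 <= tau ^+ (3 * #|K :\: XF.2|) * rc_wt (XF.2 :|: K).
  by apply: wt_open => //; rewrite setCK subsetIr.
apply: (le_trans (ler_pM (ltW (wt_gt0 _)) (ltW (wt_gt0 _)) H1 H2)).
rewrite mulrACA -exprD /pwt; apply: ler_wpM2r; first by rewrite mulr_ge0 // ltW // wt_gt0.
apply: ler_wiXn2l => //; apply: leq_trans (cluster_out GX _ PL) _.
rewrite -/(cluster e XF) -/K -mulnDr leq_mul2l /=.
have sub : K :&: closed_pair XF.1 XF.2 \subset (K :\: XF.1) :|: (K :\: XF.2).
  apply/subsetP => f; rewrite /closed_pair !in_setU !in_setD in_setI in_setC in_setI.
  by case: (f \in K); case: (f \in XF.1); case: (f \in XF.2).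
by apply: leq_trans (subset_leq_card sub) _; rewrite cardsU leq_subr.
Qed.

(** At most [2 ^ #|K|] configurations agree after all edges of [K] have been opened. *)
Lemma sum_open (E : {set {set edge G}}) K : (forall X, X \in E -> X :|: K \in E) ->
  \sum_(X in E) rc_wt (X :|: K) <= 2 ^+ #|K| * Z E.
Proof.
move=> upE; rewrite (partition_big (fun X => X :|: K) (mem E)) //= mulr_sumr.
apply: ler_sum => Y YE.
rewrite (eq_bigr (fun=> rc_wt Y)); last by move=> X /andP[_ /eqP ->].
rewrite sumr_const -[_ *+ _]mulr_natl ler_wpM2r ?(ltW (wt_gt0 _)) // -natrX ler_nat.
rewrite -card_powerset -(@card_in_imset _ _ (fun X => X :&: K)).
  apply: subset_leq_card; apply/subsetP => W /imsetP[X _ ->]; by rewrite inE subsetIr.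
move=> X X' /andP[_ /eqP XY] /andP[_ /eqP X'Y] XX'.
apply/setP => f; have := congr1 (fun S : {set edge G} => f \in S) XX'; rewrite /= !in_setI.
have := congr1 (fun S : {set edge G} => f \in S) (etrans XY (esym X'Y)); rewrite /= !in_setU.
by case: (f \in K); rewrite ?andbT ?orbF.
Qed.

Lemma big_pair (E1 E2 : {set {set edge G}}) (f g : {set edge G} -> R) :
  (\sum_(X in E1) f X) * (\sum_(F in E2) g F) =
  \sum_(XF | (XF.1 \in E1) && (XF.2 \in E2)) f XF.1 * g XF.2.
Proof. by rewrite big_distrlr /= pair_big_dep. Qed.

Variables (EB : {set edge G}).
Let E1 : {set {set edge G}} := [set X | ~: X \subset EB].
Let E2 : {set {set edge G}} := [set F | (#|~: F| <= L)%N].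
Let pairs (XF : {set edge G} * {set edge G}) := (XF.1 \in E1) && (XF.2 \in E2).

Lemma Z1_gt0 : 0 < Z E1.
Proof.
rewrite /Z (bigD1 setT) /=; last by rewrite inE setCT sub0set.
by apply: ltr_wpDr (wt_gt0 _); apply: sumr_ge0 => X _; rewrite ltW // wt_gt0.
Qed.

Lemma Z2_gt0 : 0 < Z E2.
Proof.
rewrite /Z (bigD1 setT) /=; last by rewrite inE setCT cards0.
by apply: ltr_wpDr (wt_gt0 _); apply: sumr_ge0 => X _; rewrite ltW // wt_gt0.
Qed.

Definition good_pair e (XF : {set edge G} * {set edge G}) :=
  (#|closed_pair XF.1 XF.2| <= L)%N && (cluster e XF \subset EB).

Lemma swap_good e XF : pairs XF -> good_pair e XF -> pairs (swap e XF) && good_pair e (swap e XF).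
Proof.
move=> /andP[X1 F2] /andP[PL KB]; rewrite /good_pair closed_pair_swap cluster_swap PL KB !andbT.
move: X1 F2; rewrite /pairs !inE => /subsetP X1 F2; apply/andP; split.
  apply/subsetP => f; rewrite in_setC in_splice; case: ifP => [fK _|_ fX].
    exact: (subsetP KB).
  by apply: X1; rewrite in_setC.
apply: leq_trans PL; rewrite -(closed_pair_swap e); apply: subset_leq_card.
by rewrite setCS subsetIr.
Qed.

(** The swap is a weight-preserving involution of the good pairs that exchanges the two states
    of [e], so the contributions of the good pairs cancel. *)
Lemma marginal_diff e s :
  `| (\sum_(X in E1 | (e \in X) == s) rc_wt X) / Z E1 -
     (\sum_(F in E2 | (e \in F) == s) rc_wt F) / Z E2 |
  <= (\sum_(XF | pairs XF && ~~ good_pair e XF) pwt XF) / (Z E1 * Z E2).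
Proof.
have Z1 := Z1_gt0; have Z2 := Z2_gt0; have Z12 : 0 < Z E1 * Z E2 by rewrite mulr_gt0.
pose ind (X : {set edge G}) : R := ((e \in X) == s)%:R.
have indE (E : {set {set edge G}}) : \sum_(X in E | (e \in X) == s) rc_wt X =
  \sum_(X in E) rc_wt X * ind X.
  by rewrite big_mkcondr; apply: eq_bigr => X _; rewrite /ind; case: eqP; rewrite ?mulr1 ?mulr0.
set S1 := \sum_(X in E1 | _) _; set S2 := \sum_(F in E2 | _) _.
have -> : S1 / Z E1 - S2 / Z E2 = (S1 * Z E2 - Z E1 * S2) / (Z E1 * Z E2).
  by field; rewrite !gt_eqF.
rewrite normrM normfV (gtr0_norm Z12) ler_pM2r ?invr_gt0 //.
have -> : S1 * Z E2 = \sum_(XF | pairs XF) pwt XF * ind XF.1.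
  by rewrite /S1 indE big_pair; apply: eq_bigr => XF _; rewrite /pwt mulrAC.
have -> : Z E1 * S2 = \sum_(XF | pairs XF) pwt XF * ind XF.2.
  by rewrite /S2 indE big_pair; apply: eq_bigr => XF _; rewrite /pwt mulrA.
rewrite !(bigID (good_pair e) pairs) /=.
have -> : \sum_(XF | pairs XF && good_pair e XF) pwt XF * ind XF.1 =
          \sum_(XF | pairs XF && good_pair e XF) pwt XF * ind XF.2.
  rewrite (reindex_inj (inv_inj (swapK e))) /=; apply: eq_big => XF.
    apply/idP/idP => /andP[p g]; last exact: swap_good.
    by have := swap_good p g; rewrite swapK.
  move=> /andP[p g]; have := swap_good p g; rewrite swapK => /andP[_ /andP[PL _]].
  by rewrite (pwt_swap _ PL) /ind -swap_edge.
rewrite opprD addrACA subrr add0r -sumrB.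
apply: le_trans (ler_norm_sum _ _ _) _; apply: ler_sum => XF _.
rewrite -mulrBr normrM ger0_norm ?pwt_ge0 // -[leRHS]mulr1 ler_wpM2l ?pwt_ge0 //.
by rewrite /ind; do 2 case: (_ == s); rewrite ?subrr ?subr0 ?sub0r ?normrN ?normr1 ?normr0.
Qed.

(** As the ball has at most [L / 2] edges, more than [L / 2] edges are closed in the ordered
    configuration. Its weight is compared with that of the fully open one, and the number of
    configurations is bounded by [2 ^ #|edge G|]. *)
Lemma many_closed : (2 * #|EB| <= L)%N ->
  \sum_(XF | pairs XF && (L < #|closed_pair XF.1 XF.2|)%N) pwt XF <=
    2 ^+ #|edge G| * tau ^+ L * (Z E1 * Z E2).
Proof.
move=> EBL; have /andP[t0 t1] := tau01.
have wF F : F \in E2 -> (L < 2 * #|~: F|)%N -> rc_wt F <= tau ^+ L * Z E2.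
  rewrite inE => FL LF; have [a cF Da] := comps_ordered GX FL.
  have le1 : rc_wt F <= tau ^+ (3 * #|~: F|) * (q * y ^+ #|edge G|).
    rewrite /rc_wt cF -(cardsC F) exprD exprS; have := cost Da.
    move: (tau ^+ _) (y ^+ #|~: F|) => t u qa.
    rewrite [leRHS](_ : _ = q * (u * t) * y ^+ #|F|); last by move: (y ^+ _) => v; ring.
    by rewrite ler_wpM2r ?exprn_ge0 ?(ltW y_gt0) // ler_wpM2l ?(ltW q_gt0).
  apply: le_trans le1 _; apply: ler_pM;
    rewrite ?exprn_ge0 ?mulr_ge0 ?(ltW q_gt0) ?exprn_ge0 ?(ltW y_gt0) //.
    by apply: ler_wiXn2l => //; lia.
  rewrite /Z (bigD1 setT) /=; last by rewrite inE setCT cards0.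
  rewrite -[leLHS]addr0; apply: lerD; last by apply: sumr_ge0 => X _; rewrite ltW // wt_gt0.
  rewrite /rc_wt cardsT ler_wpM2r ?exprn_ge0 ?(ltW y_gt0) // -[leLHS]expr1 ler_weXn2l //.
  have : (#|comp_set F| > 0)%N by rewrite cF.
  rewrite !card_gt0 => /set0Pn[C /imsetP[x _ _]]; apply/set0Pn.
  by exists (comp_of (setT : {set edge G}) x); apply: comp_in.
apply: (@le_trans _ _ (\sum_(XF | pairs XF) rc_wt XF.1 * (tau ^+ L * Z E2))).
  apply: (@le_trans _ _ (\sum_(XF | pairs XF && (L < #|closed_pair XF.1 XF.2|)%N)
    rc_wt XF.1 * (tau ^+ L * Z E2))).
    apply: ler_sum => XF /andP[/andP[X1 F2] PL]; rewrite /pwt ler_wpM2l ?(ltW (wt_gt0 _)) //.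
    apply: wF => //; move: X1; rewrite inE => /subset_leq_card.
    move: PL EBL; rewrite /closed_pair setCI cardsU.
    by move: #|~: XF.1| #|~: XF.2| #|_ :&: _| #|EB| => a b c d; lia.
  apply: ler_sum_subpred => [XF /andP[]//|XF _].
  by rewrite !mulr_ge0 ?exprn_ge0 ?Z_ge0 // ltW // wt_gt0.
rewrite -(big_pair E1 E2 rc_wt (fun=> tau ^+ L * Z E2)) -/(Z E1) sumr_const -[_ *+ _]mulr_natl.
rewrite [leRHS](_ : _ = Z E1 * (2 ^+ #|edge G| * (tau ^+ L * Z E2))); last first.
  by move: (Z E1) (Z E2) (2 ^+ _) (tau ^+ _) => a b c d; ring.
rewrite ler_wpM2l ?Z_ge0 // ler_wpM2r ?mulr_ge0 ?exprn_ge0 ?Z_ge0 //.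
rewrite -natrX ler_nat -(cardsT (edge G)) -card_powerset powersetT cardsT; exact: max_card.
Qed.

(* Per edge of a cluster, [2 * D + 1] counts the edge and the boundary edges next to it, and 4
   the states that the edge can have in a pair of configurations. *)
Variable rho : R.
Hypothesis rho_le1 : rho <= 1.
Hypothesis tau_rho : 4 * tau * 2 ^+ (2 * D).+1 <= rho.

Let z : R := (2 ^+ (2 * D).+1)^-1.

(** Each [z ^ #|K|] is at most the probability that [K] is the percolation cluster of [e]. *)
Lemma cluster_sum e : \sum_(K : {set edge G} | (e \in K) && (line_comp K e == K)) z ^+ #|K| <= 1.
Proof.
have N0 : 0 < 2 ^+ #|edge G| :> R by rewrite exprn_gt0.
rewrite -(ler_pM2l N0) mulr1 mulr_sumr; have := percolation_count e.
rewrite -(ler_nat R) natrX natr_sum; apply: le_trans; apply: ler_sum => K _.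
rewrite natrX /z exprVn -exprM ler_pdivrMr ?exprn_gt0 // -exprD ler_weXn2l ?ler1n //.
have := card_line_boundary GX K; have : (#|K| + #|line_boundary K| <= #|edge G|)%N.
  have := cardsUI K (line_boundary K); suff -> : K :&: line_boundary K = set0.
    by rewrite cards0 addn0 => <-; apply: max_card.
  by apply/setP => f; rewrite in_setI in_line_boundary in_set0; case: (f \in K).
by nia.
Qed.

(** Opening the cluster [K] gains [tau ^ #|K|], the map is at most [4 ^ #|K|] to one on pairs,
    and [rho] absorbs the number of connected sets [K]. *)
Lemma long_cluster e r :
  (forall XF, pairs XF -> ~~ (cluster e XF \subset EB) -> (r < #|cluster e XF|)%N) ->
  \sum_(XF | pairs XF && (#|closed_pair XF.1 XF.2| <= L)%N && ~~ (cluster e XF \subset EB)) pwt XF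
    <= rho ^+ r.+1 * (Z E1 * Z E2).
Proof.
move=> long; have /andP[t0 t1] := tau01.
pose KK (K : {set edge G}) := [&& e \in K, line_comp K e == K & (r < #|K|)%N].
have z0 : 0 <= z by rewrite invr_ge0 exprn_ge0.
have rho0 : 0 <= rho by apply: le_trans tau_rho; rewrite !mulr_ge0 // exprn_ge0.
rewrite (partition_big (cluster e) KK) /=; last first.
  move=> XF /andP[/andP[p _] KB]; rewrite /KK long // line_comp_idem eqxx !andbT.
  rewrite /cluster; apply: line_comp_refl; apply: contraR KB => eB.
  by rewrite /cluster line_comp_out // sub0set.
apply: (@le_trans _ _ (\sum_(K | KK K) rho ^+ r.+1 * z ^+ #|K| * (Z E1 * Z E2))); last first.
  rewrite -mulr_suml -mulr_sumr ler_wpM2r ?mulr_ge0 ?Z_ge0 // -[leRHS]mulr1 ler_wpM2l ?exprn_ge0 //.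
  apply: le_trans (cluster_sum e).
  apply: ler_sum_subpred => [K /and3P[eK lK _]|K _]; last by rewrite exprn_ge0.
  by rewrite eK.
apply: ler_sum => K /and3P[_ _ rK].
apply: (@le_trans _ _ (\sum_(XF | pairs XF)
  tau ^+ #|K| * (rc_wt (XF.1 :|: K) * rc_wt (XF.2 :|: K)))).
  apply: le_trans (ler_sum_subpred (P := fun XF => pairs XF && (#|closed_pair XF.1 XF.2| <= L)%N &&
    ~~ (cluster e XF \subset EB) && (cluster e XF == K)) _ _).
  - by apply: ler_sum => XF /andP[/andP[/andP[_ PL] _] /eqP <-]; apply: pwt_open.
  - by move=> XF /andP[/andP[/andP[]]].
  - by move=> XF _; rewrite mulr_ge0 ?exprn_ge0 // mulr_ge0 // ltW // wt_gt0.
rewrite -mulr_sumr -(big_pair E1 E2 (fun X => rc_wt (X :|: K)) (fun F => rc_wt (F :|: K))).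
have up1 : \sum_(X in E1) rc_wt (X :|: K) <= 2 ^+ #|K| * Z E1.
  apply: sum_open => X; rewrite !inE setCU; apply: subset_trans; exact: subsetIl.
have up2 : \sum_(F in E2) rc_wt (F :|: K) <= 2 ^+ #|K| * Z E2.
  apply: sum_open => X; rewrite !inE setCU; apply: leq_trans; apply: subset_leq_card;
    exact: subsetIl.
have s0 (E : {set {set edge G}}) : 0 <= \sum_(X in E) rc_wt (X :|: K).
  by apply: sumr_ge0 => X _; rewrite ltW // wt_gt0.
apply: (le_trans (ler_wpM2l (exprn_ge0 _ t0) (ler_pM (s0 _) (s0 _) up1 up2))).
rewrite [leLHS](_ : _ = (4 * tau) ^+ #|K| * (Z E1 * Z E2)); last first.
  rewrite exprMn (_ : 4 = 2 * 2) ?exprMn; last by rewrite -natrM.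
  by move: (Z E1) (Z E2) (2 ^+ _) (tau ^+ _) => a b c d; ring.
rewrite ler_wpM2r ?mulr_ge0 ?Z_ge0 //.
have le4 : 4 * tau <= rho * z by rewrite /z ler_pdivlMr ?exprn_gt0.
apply: (@le_trans _ _ ((rho * z) ^+ #|K|)); first by rewrite lerXn2r // nnegrE ?mulr_ge0.
by rewrite exprMn ler_wpM2r ?exprn_ge0 // ler_wiXn2l.
Qed.

(** A pair that is not good has many closed edges or a cluster that leaves the ball. *)
Lemma marginal_close e r s : (2 * #|EB| <= L)%N ->
  (forall B f, f \in line_comp B e -> f \notin EB -> (r < #|line_comp B e|)%N) ->
  `| (\sum_(X in E1 | (e \in X) == s) rc_wt X) / Z E1 -
     (\sum_(F in E2 | (e \in F) == s) rc_wt F) / Z E2 |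
  <= 2 ^+ #|edge G| * tau ^+ L + rho ^+ r.+1.
Proof.
move=> EBL far; apply: le_trans (marginal_diff e s) _.
rewrite ler_pdivrMr ?mulr_gt0 ?Z1_gt0 ?Z2_gt0 // mulrDl.
rewrite (bigID (fun XF => (L < #|closed_pair XF.1 XF.2|)%N)) /=; apply: lerD.
  apply: le_trans (many_closed EBL).
  apply: ler_sum_subpred => [XF /andP[/andP[p _] big]|XF _]; last exact: pwt_ge0.
  by rewrite p.
have long XF : pairs XF -> ~~ (cluster e XF \subset EB) -> (r < #|cluster e XF|)%N.
  by move=> _ /subsetPn[f]; apply: far.
apply: le_trans (long_cluster long); apply: ler_sum_subpred => [XF|XF _]; last exact: pwt_ge0.
by rewrite /good_pair negb_and -leqNgt -andbA; case: leqP; rewrite ?andbF ?andbT.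
Qed.

End Peierls.

(** * Random cluster measures *)

From mathcomp Require Import all_classical all_reals all_analysis.
Import numFieldNormedType.Exports.

Section Marginals.
Local Open Scope ring_scope.
Variables (R : realType) (V : finType) (G : sgraph V) (q beta : R).
Hypothesis q_gt0 : 0 < q.
Hypothesis beta_gt0 : 0 < beta.

Let y : R := expR beta - 1.
Let y_gt0 : 0 < y. Proof. by rewrite /y subr_gt0 expR_gt1. Qed.

Lemma rc_weightE (F : config G) : rc_weight q beta F = rc_wt q y (In_edges F).
Proof. by rewrite /rc_weight /rc_wt /components -n_comp_comps. Qed.

Lemma sum_config (P : pred {set edge G}) (f : {set edge G} -> R) :
  \sum_(F : config G | P (In_edges F)) f (In_edges F) = \sum_(A | P A) f A.
Proof.
pose h (A : {set edge G}) : config G := [ffun e => e \in A].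
have hK : cancel h (@In_edges V G) by move=> A; apply/setP => e; rewrite inE ffunE.
have Kh : cancel (@In_edges V G) h by move=> F; apply/ffunP => e; rewrite ffunE inE.
rewrite [LHS](reindex h) /=; last by exists (@In_edges V G) => ? _.
by apply: eq_big => A; rewrite hK.
Qed.

(** The total weight of all configurations cancels in the conditional measure. *)
Lemma marginal_cond (E : {set config G}) (E' : {set {set edge G}}) (e : edge G) s :
  (forall F, (F \in E) = (In_edges F \in E')) ->
  marginal (cond_on (rc q beta) E) e s =
  (\sum_(X in E' | (e \in X) == s) rc_wt q y X) / Z q y E'.
Proof.
move=> EE'; set W := \sum_(F : config G) rc_weight q beta F.
have W_gt0 : 0 < W.
  have wp A : 0 < rc_wt q y A by rewrite /rc_wt mulr_gt0 // exprn_gt0.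
  rewrite /W (bigD1 [ffun=> true]) //= ltr_wpDr ?rc_weightE //.
  by apply: sumr_ge0 => F _; rewrite rc_weightE ltW.
have sE : \sum_(F in E) rc q beta F = Z q y E' / W.
  rewrite /Z -(sum_config (fun A => A \in E')) mulr_suml; apply: eq_big => F; first exact: EE'.
  by rewrite /rc rc_weightE.
rewrite /marginal -(sum_config (fun A => (A \in E') && ((e \in A) == s))) mulr_suml.
rewrite /cond_on sE [RHS]big_mkcond [LHS]big_mkcond /=; apply: eq_bigr => F _.
rewrite EE'; case: (In_edges F \in E'); case: (_ == s) => //=.
rewrite /rc -/W rc_weightE invfM invrK mulrA mulrAC; congr (_ / _).
by rewrite mulfVK // gt_eqF.
Qed.

End Marginals.

Section Deterministic.
Local Open Scope ring_scope.
Variables (R : realType) (V : finType) (G : sgraph V) (D L : nat).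

Lemma WSM_of_expander (q beta eta tau rho : R) r : expander G D L -> 1 <= q -> 0 < beta ->
  0 <= tau <= 1 -> rho <= 1 -> 4 * tau * 2 ^+ (2 * D).+1 <= rho ->
  (forall k a : nat, (5 * D * k <= 9 * a)%N -> q ^+ k <= (expR beta - 1) ^+ a * tau ^+ (3 * a)) ->
  (forall a : nat, (a <= L)%N = (a%:R <= eta * #|edge G|%:R)) ->
  (2 * D.+1 ^ r.+1 <= L)%N ->
  2 ^+ #|edge G| * tau ^+ L + rho ^+ r.+1 <= (100 * #|edge G|%:R)^-1 ->
  WSM_ord G q beta eta r.
Proof.
move=> GX q1 b0 t01 rho1 tr cost LE ballL small v e ve.
have q0 : 0 < q by apply: lt_le_trans q1.
have y0 : 0 < expR beta - 1 by rewrite subr_gt0 expR_gt1.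
set EB := [set f : edge G | ends f \subset ball_at G r v]%SET.
have H1 F : (F \in [set F : config G | [forall e : edge G,
       ~~ (ends e \subset ball_at G r v) ==> (e \in In_edges F)]]%SET) =
     (In_edges F \in [set X : {set edge G} | ~: X \subset EB]%SET).
  rewrite !inE; apply/forallP/fintype.subsetP => H f.
    rewrite finset.in_setC => fF; rewrite inE; apply: contraR fF => fb.
    by have := H f; rewrite fb.
  apply/implyP; apply: contraR => fF; have := H f; rewrite finset.in_setC fF inE; exact.
have H2 F : (F \in Omega_ord G eta) =
     (In_edges F \in [set X : {set edge G} | (#|~: X| <= L)%N]%SET).
  rewrite !inE LE; have := cardsC (In_edges F).
  move=> /(congr1 (fun k => k%:R : R)); rewrite natrD => <-.
  move: (#|In_edges F|%:R : R) (#|~: In_edges F|%:R : R) => a b; clear.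
  by rewrite mulrBl mul1r lerBlDr lerD2l.
have bound s : `|marginal (rc_ball_plus q beta r v) e s - marginal (rc_ord q beta eta) e s|
    <= (100 * #|edge G|%:R)^-1.
  rewrite /rc_ball_plus /rc_ord (marginal_cond q0 b0 _ _ H1) (marginal_cond q0 b0 _ _ H2).
  apply: le_trans small; apply: (marginal_close GX) => //.
    by apply: leq_trans ballL; rewrite leq_mul2l /= (card_ball_edges (expander_regular GX)).
  by move=> B f fK; rewrite inE; apply: line_comp_escapes.
have := lerD (bound true) (bound false); rewrite -mulr2n -[leRHS]mulr_natl.
by rewrite /tv_dist big_bool /= ler_pdivrMl.
Qed.

End Deterministic.

(** * Expansion, threshold and size estimates *)

Section Estimates.
Local Open Scope ring_scope.
Variable R : realType.
Implicit Types q beta eta : R.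

Lemma expansion_cut (V : finType) (G : sgraph V) (D : nat) (c eps : R) (S : {set V}) :
  (0 < D)%N -> (c%:E <= expansion D G eps)%E -> (0 < #|S|)%N -> #|S|%:R <= eps * #|V|%:R ->
  c * (D * #|S|)%:R <= #|cut_edges G S|%:R.
Proof.
move=> D0 cG S0 Seps; rewrite -ler_pdivlMr ?ltr0n ?muln_gt0 ?D0 // -lee_fin.
by apply: le_trans cG _; rewrite /expansion; apply: bigmin_le_cond; rewrite S0.
Qed.

Lemma ler_natr_div (a b c : nat) : (0 < b)%N -> (b * a <= c)%N -> a%:R <= b%:R^-1 * c%:R :> R.
Proof. by move=> b0 H; rewrite -ler_pdivrMl ?invr_gt0 ?ltr0n // invrK -natrM ler_nat. Qed.

(** A boundary of [eta * m] edges cuts off at most [5 * eta * n] vertices when the expansion is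
    1/10, which is why [eta <= delta / 5] is required. *)
Lemma expander_of_expansion (V : finType) (G : sgraph V) (D : nat) (delta eta : R) :
  (0 < D)%N -> (0 < #|V|)%N -> regular D G -> 0 <= eta -> 5 * eta <= delta -> eta <= 1 / 100 ->
  ((1 / 10)%:E <= expansion D G (1 / 2 : R))%E -> ((5 / 9)%:E <= expansion D G delta)%E ->
  expander G D (Num.truncn (eta * #|edge G|%:R)).
Proof.
move=> D0 V0 G_reg eta0 eta5 eta100 half small.
have m2 : 2 * #|edge G|%:R = D%:R * #|V|%:R :> R by rewrite -!natrM (handshake G_reg).
have Dp : 0 < D%:R :> R by rewrite ltr0n.
have Vp : 0 < #|V|%:R :> R by rewrite ltr0n.
have DVp := mulr_gt0 Dp Vp.
set L := Num.truncn _.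
have LE : L%:R <= eta * #|edge G|%:R by rewrite truncn_le // mulr_ge0.
have etaDV : eta * #|edge G|%:R = 2^-1 * (eta * (D%:R * #|V|%:R)) by rewrite -m2; field.
split=> // [S S0 S2|S SL|].
- have Sh : #|S|%:R <= 1 / 2 * #|V|%:R :> R by rewrite mul1r; apply: ler_natr_div.
  have := expansion_cut D0 half S0 Sh; rewrite -(ler_nat R) [(10 * _)%:R]natrM.
  by move: ((D * #|S|)%:R : R) (#|cut_edges G S|%:R : R) => a b; clear; lra.
- have [->|S0] := posnP #|S|; first by rewrite muln0.
  have Sd : #|S|%:R <= delta * #|V|%:R.
    rewrite -(ler_pM2l Dp); move: SL; rewrite -(ler_nat R) !natrM => SL.
    apply: le_trans SL _; apply: (@le_trans _ _ (10 * (eta * #|edge G|%:R))).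
      by rewrite ler_wpM2l.
    rewrite etaDV mulrCA [leRHS]mulrCA; have := ler_wpM2r (ltW DVp) eta5.
    by move: (D%:R * #|V|%:R) => w; clear; lra.
  have := expansion_cut D0 small S0 Sd; rewrite -(ler_nat R) -mulnA ![(_ * _)%:R]natrM -natrM.
  by move: ((D * #|S|)%:R : R) (#|cut_edges G S|%:R : R) => a b; clear; lra.
- rewrite -(ltr_nat R) !natrM; apply: (@le_lt_trans _ _ (20 * (eta * #|edge G|%:R))).
    by rewrite ler_wpM2l.
  rewrite etaDV; have := ler_wpM2r (ltW DVp) eta100; move: DVp.
  by move: (D%:R * #|V|%:R) => w; clear; lra.
Qed.

Lemma expR1_ge2 : 2 <= expR 1 :> R.
Proof. by apply: le_trans (expR_ge1Dx 1). Qed.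

Lemma natr_le_expR (n : nat) : n.+1%:R <= expR n%:R :> R.
Proof. by apply: le_trans (expR_ge1Dx _); rewrite -natr1 addrC. Qed.

(** The ratio inside the logarithm of [beta_c] is at least [(q - 1) ^ (2 / D) / e]. Here [e]
    bounds [(q - 1) / (q - 2)], and [q / (q - 1)], from above. *)
Lemma q_le_of_beta_c q beta (D : nat) : (3 <= D)%N -> 3 <= q -> beta_c q D <= beta ->
  q <= expR (D%:R / 2 * (beta + 2)).
Proof.
move=> D3 q3; have D3R : 3 <= D%:R :> R by rewrite ler_nat.
have Dp : 0 < D%:R :> R by apply: lt_le_trans D3R.
set x : R := 1 - 2 / D%:R; rewrite /beta_c -/x.
have x0 : 0 < x by rewrite subr_gt0 ltr_pdivrMr // mul1r; apply: lt_le_trans D3R; rewrite ltr_nat.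
have p0 : 0 < q - 1 by lra.
have lnp0 : 0 < ln (q - 1) by rewrite ln_gt0 //; lra.
have pxE : (q - 1) `^ x = expR (x * ln (q - 1)) by rewrite /powR gt_eqF.
have px1 : 1 < (q - 1) `^ x by rewrite pxE expR_gt1 mulr_gt0.
have low : expR (ln (q - 1) - 1 - x * ln (q - 1)) <= (q - 2) / ((q - 1) `^ x - 1).
  rewrite ler_pdivlMr ?subr_gt0 // !expRD !expRN lnK ?posrE // -pxE.
  apply: (@le_trans _ _ ((q - 1) / expR 1)).
    rewrite -[X in X <= _]mulrA ler_piMr ?divr_ge0 ?expR_ge0 ?(ltW p0) //.
    by rewrite ler_pdivrMl ?(lt_trans ltr01) // mulr1; lra.
  rewrite ler_pdivrMr ?expR_gt0 //; have := expR1_ge2; nra.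
move=> bc; have : ln (q - 1) - 1 - x * ln (q - 1) <= beta.
  apply: le_trans bc; rewrite -[leLHS]expRK ler_ln ?posrE ?expR_gt0 //.
  by apply: lt_le_trans low; rewrite expR_gt0.
rewrite /x mulrBl mul1r; set w := 2 / _ * _ => Hw.
have {Hw} H : w <= beta + 1 by move: (ln (q - 1)) w Hw; clear=> a w Hw; lra.
have : ln (q - 1) <= D%:R / 2 * (beta + 1).
  have D2 : 0 <= D%:R / 2 :> R by rewrite divr_ge0.
  have := ler_wpM2l D2 H; rewrite /w mulrA.
  by rewrite (_ : D%:R / 2 * (2 / D%:R) = 1) ?mul1r //; field; rewrite gt_eqF.
move=> lnp; have : q <= expR (1 + ln (q - 1)).
  rewrite expRD lnK ?posrE //; have := expR1_ge2; nra.
move/le_trans; apply; rewrite ler_expR; apply: le_trans (lerD (lexx 1) lnp) _.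
have -> : D%:R / 2 * (beta + 2) = D%:R / 2 + D%:R / 2 * (beta + 1) by ring.
by rewrite lerD2r ler_pdivlMr // mul1r (le_trans _ D3R) // ler_nat.
Qed.

(** Creating [k] components gains at most [exp (9 / 10 * (beta + 2) * a)], as [a] is at least
    [5 * D * k / 9], while the [a] closed edges cost almost [exp (beta * a)]. *)
Lemma ordered_cost q beta (D : nat) : 0 <= q -> q <= expR (D%:R / 2 * (beta + 2)) -> 56 <= beta ->
  forall k a : nat, (5 * D * k <= 9 * a)%N ->
    q ^+ k <= (expR beta - 1) ^+ a * expR (- (beta / 60)) ^+ (3 * a).
Proof.
move=> q0 qle b56 k a ka.
have kaR : k%:R * D%:R <= 9 / 5 * a%:R :> R.
  by move: ka; rewrite -(ler_nat R) !natrM mulrAC mulrC; lra.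
apply: (@le_trans _ _ (expR (9 / 10 * (beta + 2)) ^+ a)).
  apply: (@le_trans _ _ (expR (D%:R / 2 * (beta + 2)) ^+ k));
    first by rewrite lerXn2r ?nnegrE ?expR_ge0.
  rewrite -!expRM_natl ler_expR.
  have b0 : 0 <= beta + 2 by lra.
  by have := ler_wpM2r b0 kaR; move: (k%:R * D%:R) => *; nra.
rewrite exprM -exprMn -(expRM_natl 3) lerXn2r ?nnegrE ?mulr_ge0 ?expR_ge0 //.
  by rewrite subr_ge0 -[leLHS]expR0 ler_expR; lra.
apply: (@le_trans _ _ (expR (beta - 1) * expR (3 * - (beta / 60)))).
  by rewrite -expRD ler_expR; lra.
rewrite ler_wpM2r ?expR_ge0 //.
have e1 : 1 <= expR (beta - 1) by rewrite -[leLHS]expR0 ler_expR; lra.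
have -> : expR beta = expR (beta - 1) * expR 1 by rewrite -expRD subrK.
move: (expR (beta - 1)) (expR 1 : R) e1 expR1_ge2 => u w u1 w2.
by rewrite -subr_ge0 (_ : _ - _ = u * (w - 2) + (u - 1)); [rewrite addr_ge0 ?mulr_ge0; lra | ring].
Qed.

Lemma radius_ge1 beta (n : nat) : 0 < beta -> expR (beta / 240) <= n%:R ->
  (1 <= Num.truncn (240 / beta * ln (n%:R : R)))%N.
Proof.
move=> b0 nb; rewrite truncn_gt0.
have : beta / 240 <= ln (n%:R : R).
  by rewrite -[leLHS]expRK ler_ln ?posrE ?expR_gt0 // (lt_le_trans (expR_gt0 _) nb).
move=> H; have := ler_wpM2l (ltW (divr_gt0 (ltr0n _ 240) b0)) H; apply: le_trans.
by rewrite le_eqVlt; apply/orP; left; apply/eqP; field; rewrite gt_eqF.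
Qed.

(** With [480 * D <= beta] the radius is at most [log n / (2 * D)], so that the ball has
    [O (sqrt n)] edges because [D + 1 <= exp D]. *)
Lemma ball_small beta eta (D n m : nat) : (0 < D)%N -> (0 < n)%N -> (2 * m = D * n)%N -> 0 < eta ->
  480 * D%:R <= beta -> 64 / eta ^+ 2 <= n%:R ->
  (2 * D.+1 ^ (Num.truncn (240 / beta * ln (n%:R : R))).+1 <= Num.truncn (eta * m%:R))%N.
Proof.
move=> D0 n0 mn eta0 bD neta; have Dp : 1 <= D%:R :> R by rewrite ler1n.
have b0 : 0 < beta by lra.
have np : 0 < n%:R :> R by rewrite ltr0n.
have ln0 : 0 <= ln (n%:R : R) by rewrite ln_ge0 // ler1n.
set r := Num.truncn _; have rle : r%:R <= 240 / beta * ln (n%:R : R).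
  by rewrite truncn_le mulr_ge0 ?divr_ge0 ?ler0n ?(ltW b0).
rewrite truncn_ge_nat ?mulr_ge0 ?(ltW eta0) // natrM natrX exprS.
set s := expR (ln (n%:R : R) / 2).
have s2 : s ^+ 2 = n%:R by rewrite /s -expRM_natl mulrCA divff // mulr1 lnK.
have pow : D.+1%:R ^+ r <= s.
  apply: (@le_trans _ _ (expR D%:R ^+ r)); first by rewrite lerXn2r ?nnegrE ?expR_ge0 ?natr_le_expR.
  rewrite -expRM_natl ler_expR; apply: (@le_trans _ _ (240 / beta * ln (n%:R : R) * D%:R)).
    by rewrite ler_wpM2r // ler0n.
  rewrite mulrAC mulrC ler_wpM2l // mulrAC ler_pdivrMr //; lra.
have s8 : 8 <= eta * s.
  have es0 : 0 <= eta * s by rewrite mulr_ge0 ?expR_ge0 ?ltW.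
  rewrite -ler_sqr ?nnegrE // exprMn s2; move: neta; rewrite ler_pdivrMr ?exprn_gt0 //.
  by rewrite mulrC; apply: le_trans; rewrite -natrX ler_nat.
have mE : m%:R = D%:R * s ^+ 2 / 2 :> R.
  by rewrite s2 -natrM -mn natrM mulrAC divff ?mul1r.
have s0 : 0 < s := expR_gt0 _.
rewrite mE; apply: (@le_trans _ _ (2 * (D.+1%:R * s))); first by rewrite !ler_wpM2l.
have -> : eta * (D%:R * s ^+ 2 / 2) = eta * s * D%:R / 2 * s by ring.
rewrite mulrA ler_wpM2r ?(ltW s0) // -[D.+1%:R]natr1.
have := ler_wpM2r (ler0n R D) s8; move: (eta * s * D%:R) (D%:R : R) Dp.
by clear=> u d; lra.
Qed.

(** The number [2 ^ m] of configurations is at most [exp m], and each has probability at most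
    [exp (- 2 * m)] up to a constant factor. *)
Lemma closed_small beta eta (m : nat) : 0 <= beta -> 120 <= beta * eta -> (0 < m)%N ->
  800 * expR (beta / 60) <= m%:R ->
  2 ^+ m * expR (- (beta / 60)) ^+ Num.truncn (eta * m%:R) <= (200 * m%:R)^-1.
Proof.
move=> b0 be m0 mb; have mp : 0 < m%:R :> R by rewrite ltr0n.
set L := Num.truncn _; have LE : eta * m%:R - 1 <= L%:R.
  by rewrite lerBlDr natr1 ltW // truncnS_gt.
apply: (@le_trans _ _ (expR m%:R * expR (- (beta / 60) * L%:R))).
  apply: ler_pM; rewrite ?exprn_ge0 ?expR_ge0 //.
    have -> : expR m%:R = expR 1 ^+ m :> R by rewrite -expRM_natl mulr1.
    by rewrite lerXn2r ?nnegrE ?expR_ge0 ?expR1_ge2.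
  by rewrite [- _ * _]mulrC expRM_natl.
rewrite -expRD; apply: (@le_trans _ _ (expR (beta / 60 - m%:R))).
  rewrite ler_expR; have bL := ler_wpM2l b0 LE; have bm := ler_wpM2r (ltW mp) be.
  by move: bL bm; rewrite mulrBr mulr1 mulrA; lra.
rewrite expRD expRN ler_pdivrMr ?expR_gt0 // [leRHS]mulrC ler_pdivlMr ?mulr_gt0 ?ltr0n //.
have -> : expR m%:R = expR (m%:R / 2) ^+ 2 :> R by rewrite -expRM_natl mulrCA divff ?mulr1.
have : m%:R / 2 <= expR (m%:R / 2) :> R by apply: le_trans (expR_ge1Dx _); lra.
move: (expR (m%:R / 2)) (expR (beta / 60)) mb => u w mb mu.
apply: (@le_trans _ _ ((m%:R / 2) ^+ 2)); first by rewrite expr2; nra.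
by rewrite lerXn2r ?nnegrE //; lra.
Qed.

(** The radius is chosen to make the left-hand side at most [n ^ (- 2)]. *)
Lemma far_small beta (D n m : nat) : 0 < beta -> (0 < D)%N -> (0 < n)%N -> (2 * m = D * n)%N ->
  (100 * D <= n)%N ->
  expR (- (beta / 120)) ^+ (Num.truncn (240 / beta * ln (n%:R : R))).+1 <= (200 * m%:R)^-1.
Proof.
move=> b0 D0 n0 mn nD; have np : 0 < n%:R :> R by rewrite ltr0n.
set r := Num.truncn _.
have rlt : 240 / beta * ln (n%:R : R) <= r.+1%:R by rewrite ltW // truncnS_gt.
have m0 : (0 < m)%N by nia.
apply: (@le_trans _ _ (expR (ln (n%:R : R) *+ 2))^-1).
  rewrite -expRM_natl -expRN ler_expR mulrN lerN2.
  have b120 : 0 <= beta / 120 by lra.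
  apply: le_trans (ler_wpM2r b120 rlt); rewrite le_eqVlt; apply/orP; left; apply/eqP.
  by rewrite -[ln _ *+ 2]mulr_natl; field; rewrite gt_eqF.
rewrite (_ : expR _ = n%:R ^+ 2); last by rewrite -[ln _ *+ 2]mulr_natl expRM_natl lnK.
rewrite lef_pV2 ?posrE ?exprn_gt0 ?mulr_gt0 ?ltr0n //.
by rewrite -natrM -natrX ler_nat; nia.
Qed.

End Estimates.

(** * Conclusion *)

Section WithHighProbability.
Local Open Scope classical_set_scope.
Local Open Scope ring_scope.
Variables (R : realType) (D : nat).

(** The probability is squeezed between that of [P] and 1; if there is no regular graph, both
    probabilities are 0. *)
Lemma whp_mono (P Q : forall n, sgraph 'I_n -> Prop) (n0 : nat) :
  (forall n (G : sgraph 'I_n), (n0 <= n)%N -> regular D G -> P n G -> Q n G) ->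
  whp R D P -> whp R D Q.
Proof.
move=> PQ Pwhp; apply: (squeeze_cvgr _ Pwhp (cvg_cst (1 : R))).
exists n0 => // n /= n0n _; apply/andP; split; rewrite /Pr_regular.
  rewrite ler_wpM2r ?invr_ge0 ?ler0n // ler_nat; apply: subset_leq_card.
  apply/fintype.subsetP => G; rewrite !inE => /andP[rG /asboolP PG]; rewrite rG /=.
  by apply/asboolP; apply: PQ.
set a := #|_|; set b := #|_|; have ab : (a <= b)%N.
  by apply: subset_leq_card; apply/fintype.subsetP => G; rewrite !inE => /andP[].
have [->|b0] := posnP b; first by rewrite invr0 mulr0 ler01.
by rewrite ler_pdivrMr ?ltr0n // mul1r ler_nat.
Qed.

End WithHighProbability.

Local Open Scope ring_scope.

Theorem theorem5 (R : realType) (Delta : nat) (hDelta : (5 <= Delta)%N)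
    (delta : R) (hdelta : 0 < delta < 1 / 2)
    (hexp : whp R Delta (fun n (G : sgraph 'I_n) =>
       ((1 / 10)%:E <= expansion Delta G (1 / 2 : R))%E /\
       ((5 / 9)%:E <= expansion Delta G delta)%E)) :
  exists M : R, 0 < M /\
    exists q0 : R, forall q : R, q0 <= q ->
      forall beta : R, beta_c q Delta <= beta ->
        whp R Delta (fun n (G : sgraph 'I_n) =>
          exists r : nat, [/\ (1 <= r)%N,
            r%:R <= M / beta * ln (n%:R : R) &
            WSM_ord G q beta (eta_of delta) r]).
Proof.
have /andP[delta_gt0 _] := hdelta.
have D_gt0 : (0 < Delta)%N by apply: leq_trans hDelta.
set eta := eta_of delta.
have eta_gt0 : 0 < eta by rewrite /eta /eta_of lt_min !divr_gt0.
have eta_delta : 5 * eta <= delta.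
  by rewrite mulrC -ler_pdivlMr //; rewrite /eta /eta_of ge_min lexx.
have eta_100 : eta <= 1 / 100 by rewrite /eta /eta_of ge_min lexx orbT.
(* The four terms serve the cost of a closed edge, the number of connected edge sets, the size
   of the ball and the number of configurations. *)
pose B : R := 56 + 120 * (2 * Delta + 3)%:R + 480 * Delta%:R + 120 / eta.
exists 240; split; first by rewrite ltr0n.
exists (3 + expR (Delta%:R / 2 * (B + 2))) => q q_large beta beta_large.
have e0 : 0 < expR (Delta%:R / 2 * (B + 2)) by rewrite expR_gt0.
have q_le := q_le_of_beta_c (leq_trans (isT : 3 <= 5)%N hDelta) (le_trans _ q_large) beta_large.
have {}q_le : q <= expR (Delta%:R / 2 * (beta + 2)) by apply: q_le; lra.
have q_ge1 : 1 <= q by lra.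
have B_beta : B <= beta.
  have : expR (Delta%:R / 2 * (B + 2)) <= expR (Delta%:R / 2 * (beta + 2)) by lra.
  by rewrite ler_expR ler_pM2l ?lerD2r // divr_gt0 // ltr0n.
have eta_inv : 0 < 120 / eta by rewrite divr_gt0.
have [b56 bD3 bD beta_eta] : [/\ 56 <= beta, 120 * (2 * Delta + 3)%:R <= beta,
    480 * Delta%:R <= beta & 120 / eta <= beta].
  have x1 : 0 <= (2 * Delta + 3)%:R :> R by [].
  have x2 : 0 <= Delta%:R :> R by [].
  move: B_beta eta_inv x1 x2; rewrite /B.
  by move: (_%:R : R) (Delta%:R : R) (120 / eta); clear=> u v w H w0 u0 v0; split; lra.
have beta_gt0 : 0 < beta by apply: lt_le_trans b56; rewrite ltr0n.
have beta_eta' : 120 <= beta * eta by rewrite -ler_pdivrMr.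
(* The three terms serve a radius of at least 1, a ball of at most half as many edges as the
   ordered phase allows to be closed, and the rarity of configurations with many closed edges. *)
pose C : R := expR (beta / 240) + 64 / eta ^+ 2 + 800 * expR (beta / 60).
apply: (whp_mono (n0 := (100 * Delta + (Num.truncn C).+1)%N)) hexp =>
  n G n_large G_reg [half small].
have n_gt0 : (0 < n)%N by apply: leq_trans n_large; rewrite addnS.
have nC : C <= n%:R.
  apply: (@le_trans _ _ (Num.truncn C).+1%:R); first by rewrite ltW // truncnS_gt.
  by rewrite ler_nat; apply: leq_trans n_large; apply: leq_addl.
have e1 : 0 < expR (beta / 240) by rewrite expR_gt0.
have e2 : 0 < expR (beta / 60) by rewrite expR_gt0.
have e3 : 0 < 64 / eta ^+ 2 by rewrite divr_gt0 ?exprn_gt0.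
have [n1 n2 n3] : [/\ expR (beta / 240) <= n%:R,
    64 / eta ^+ 2 <= n%:R & 800 * expR (beta / 60) <= n%:R].
  by move: nC e1 e2 e3; rewrite /C; clear=> nC e1 e2 e3; split; lra.
have mn : (2 * #|edge G| = Delta * n)%N by rewrite (handshake G_reg) card_ord.
have nm : (n <= #|edge G|)%N.
  by rewrite -(leq_pmul2l (isT : 0 < 2)%N) mn leq_mul2r (leq_trans _ hDelta) ?orbT.
exists (Num.truncn (240 / beta * ln (n%:R : R))); split.
- exact: radius_ge1.
- by rewrite truncn_le mulr_ge0 ?divr_ge0 ?ler0n ?(ltW beta_gt0) ?ln_ge0 ?ler1n.
have GX : expander G Delta (Num.truncn (eta * #|edge G|%:R)).
  by apply: expander_of_expansion small => //; rewrite ?card_ord ?(ltW eta_gt0).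
have eta_m : 0 <= eta * #|edge G|%:R by rewrite mulr_ge0 ?(ltW eta_gt0) ?ler0n.
apply: (WSM_of_expander (tau := expR (- (beta / 60))) (rho := expR (- (beta / 120))) GX) => //.
- by rewrite expR_ge0 /= -[leRHS]expR0 ler_expR oppr_le0 divr_ge0 ?(ltW beta_gt0).
- by rewrite -[leRHS]expR0 ler_expR oppr_le0 divr_ge0 ?(ltW beta_gt0).
- apply: (@le_trans _ _ (expR (2 * Delta + 3)%:R * expR (- (beta / 60)))).
    have -> : 4 * expR (- (beta / 60)) * 2 ^+ (2 * Delta).+1 =
      2 ^+ (2 * Delta + 3) * expR (- (beta / 60)).
      have -> : 4 = 2 ^+ 2 :> R by rewrite -natrX.
      by rewrite mulrAC -exprD [(2 * Delta + 3)%N]addnC.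
    rewrite ler_wpM2r ?expR_ge0 //.
    have -> : expR (2 * Delta + 3)%:R = expR 1 ^+ (2 * Delta + 3) :> R by rewrite -expRM_natl mulr1.
    by rewrite lerXn2r ?nnegrE ?expR_ge0 ?expR1_ge2.
  by rewrite -expRD ler_expR; move: bD3; clear; move: (_%:R : R) => u; lra.
- by apply: ordered_cost => //; apply: le_trans q_ge1.
- by move=> a; rewrite truncn_ge_nat.
- by apply: ball_small mn _ _ _ => //.
have m0 : (0 < #|edge G|)%N by apply: leq_trans nm.
have -> : (100 * #|edge G|%:R)^-1 = (200 * #|edge G|%:R)^-1 + (200 * #|edge G|%:R)^-1 :> R.
  by field; rewrite pnatr_eq0 -lt0n.
apply: lerD; last by apply: far_small mn _ => //; apply: leq_trans n_large; apply: leq_addr.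
apply: closed_small => //; first exact: ltW.
by apply: le_trans n3 _; rewrite ler_nat.
Qed.
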